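(* Let $V$ be a simple, rational, $C_2$-cofinite, self-contragredient vertex operator algebra of CFT type with $c(V)=\widetilde c(V)=1$, and let $L$ be a positive-definite even lattice of rank one. If $\operatorname{ch}V=\operatorname{ch}V_L$, then $V\cong V_L$ as vertex operator algebras.
   Context: VOAs are over $\mathbb C$, $\mathbb Z$-graded by $L(0)$-eigenvalues with finite-dimensional weight spaces bounded below; isomorphisms preserve vacuum and conformal vector. Simple: no nonzero proper ideals. Rational: every admissible module is completely reducible. $C_2$-cofinite: $\dim V/\operatorname{span}\{u_{-2}v\}<\infty$. Self-contragredient: $V\cong V'=\bigoplus_nV_n^*$ as $V$-modules. CFT type: $V_n=0$ for $n<0$, $V_0=\mathbb C\mathbf 1$. Effective central charge: $\widetilde c(V)=c(V)-24\lambda_{\min}$, with $\lambda_{\min}$ the least conformal weight among irreducible $V$-modules. Vacuum character: $\operatorname{ch}V=\operatorname{tr}_Vq^{L(0)-c(V)/24}$. $V_L$ is the lattice VOA of $L$. *)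

(* Defs.v *)
From HB Require Import structures.
From mathcomp Require Import all_boot all_order all_algebra.
From mathcomp Require Import finmap multiset.
From mathcomp Require Import boolp classical_sets fsbigop reals.
From mathcomp Require Import complex monalg.
Set Implicit Arguments.
Unset Strict Implicit.
Unset Printing Implicit Defensive.
Import Order.TTheory GRing.Theory Num.Theory.
Local Open Scope classical_set_scope.
Local Open Scope ring_scope.

(* The notions below are written over an arbitrary numFieldType K and are
   meant to be used at K = R[i] with R : realType, i.e., over the complex
   numbers. *)


Section LinearAlgebra.
Variables (K : numFieldType) (M : lmodType K).
Implicit Types (S A : set M) (v : M).

Definition is_subspace S : Prop :=
  S 0 /\ forall (a : K) u v, S u -> S v -> S (a *: u + v).

Definition lin_span A : set M := [set v | forall S, is_subspace S -> A `<=` S -> S v].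

Definition has_dim S (n : nat) : Prop :=
  exists b : 'I_n -> M, (forall i, S (b i)) /\
    forall v, S v -> exists! a : {ffun 'I_n -> K}, v = \sum_(i < n) a i *: b i.

Definition fin_dim S : Prop := exists n, has_dim S n.

(* 0 if S is not finite-dimensional *)
Definition dim S : nat := xget 0%N [set n | has_dim S n].

(* S is meant to be a subspace *)
Definition fin_codim S : Prop :=
  exists (n : nat) (b : 'I_n -> M), forall v,
    exists (a : 'I_n -> K) (s : M), S s /\ v = \sum_(i < n) a i *: b i + s.

Definition sum_of (I : choiceType) (S : I -> set M) : set M :=
  [set v | exists (s : seq I) (f : I -> M),
     (forall i, S i (f i)) /\ v = \sum_(i <- s) f i].

Definition direct_sum_decomposition (I : choiceType) (S : I -> set M) : Prop :=
  [/\ forall i, is_subspace (S i),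
      forall v, sum_of S v
    & forall (s : seq I) (f : I -> M), uniq s -> (forall i, S i (f i)) ->
        \sum_(i <- s) f i = 0 -> forall i, i \in s -> f i = 0].

End LinearAlgebra.


(* vnth u n v is u_n v, where Y(u, z) v = \sum_n u_n v z^(-n-1). *)
Record voaData (K : numFieldType) := VoaData {
  vcar :> lmodType K;
  vnth : vcar -> int -> vcar -> vcar;
  vac : vcar;
  conf : vcar;
  ccharge : K }.

Record modData (K : numFieldType) (V : voaData K) := ModData {
  mcar :> lmodType K;
  mact : V -> int -> mcar -> mcar }.

Definition adjoint (K : numFieldType) (V : voaData K) : modData V :=
  ModData (@vnth K V).

Definition gbin (K : numFieldType) (m : int) (i : nat) : K :=
  (\prod_(j < i) (m%:~R - j%:R)) / (i`!)%:R.

Section Modules.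
Variables (K : numFieldType) (V : voaData K).
Implicit Types (M : modData V).

Definition Lop M (n : int) : M -> M := mact (conf V) (n + 1).

Definition wtspace M (lam : K) : set M := [set w | Lop 0 w = lam *: w].

(* The component form of the Jacobi identity. The sums run over all i in nat;
   they are finite by truncation, and \sum_(_ \in _) is the sum over the
   (finite) support. *)
Definition borcherds_identity M : Prop :=
  forall (u v : V) (w : M) (l m n : int),
    \sum_(i \in [set: nat])
       gbin K m i *: mact (vnth u (l + i%:Z) v) (m + n - i%:Z) w
    = \sum_(i \in [set: nat])
       ((-1) ^+ i * gbin K l i) *:
         (mact u (m + l - i%:Z) (mact v (n + i%:Z) w)
          - (-1) ^ l *: mact v (n + l - i%:Z) (mact u (m + i%:Z) w)).

Definition weak_module M : Prop :=
  [/\ (forall n (w : M), linear (fun u : V => mact u n w))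
      /\ (forall (u : V) n, linear (fun w : M => mact u n w)),
      forall (u : V) (w : M), exists N : int, forall n, N <= n -> mact u n w = 0,
      forall n (w : M), mact (vac V) n w = if n == -1 then w else 0
    & borcherds_identity M].

Definition submodule M (W : set M) : Prop :=
  is_subspace W /\ forall u n w, W w -> W (mact u n w).

Definition irreducible_module M : Prop :=
  (exists w : M, w != 0) /\
  forall W, submodule W -> W = [set 0] \/ W = [set: M].

Definition ordinary_module M : Prop :=
  [/\ weak_module M,
      direct_sum_decomposition (@wtspace M),
      forall lam, fin_dim (@wtspace M lam)
    & forall lam, exists N : nat, forall k : nat, (N <= k)%N ->
        wtspace (lam - k%:R) = [set 0 : M]].

Definition conformal_weight (h : K) : Prop :=
  exists M : modData V,
    [/\ ordinary_module M, irreducible_module M,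
        exists2 w : M, wtspace h w & w != 0
      & forall (lam : K) (w : M), wtspace lam w -> w != 0 ->
          exists n : nat, lam = h + n%:R].

Definition Lvir (n : int) : V -> V := @Lop (adjoint V) n.

Definition Vwt (n : int) : set V := @wtspace (adjoint V) n%:~R.

(* The components M(n), n in nat, extended by M(n) = 0 for n < 0. *)
Definition graded_comp M (gr : nat -> set M) (n : int) : set M :=
  if n is Posz k then gr k else [set 0].

Definition admissible_module M (gr : nat -> set M) : Prop :=
  [/\ weak_module M,
      direct_sum_decomposition gr
    & forall (k m : int) (n : nat) (u : V) (w : M),
        Vwt k u -> gr n w -> graded_comp gr (n%:Z + k - m - 1) (mact u m w)].

Definition admissible_submodule M (gr : nat -> set M) (W : set M) : Prop :=
  submodule W /\ W `<=` sum_of (fun n => W `&` gr n).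

Definition irreducible_admissible_submodule M (gr : nat -> set M) (W : set M) :=
  [/\ admissible_submodule gr W, W <> [set 0]
    & forall W', admissible_submodule gr W' -> W' `<=` W ->
        W' = [set 0] \/ W' = W].

Definition completely_reducible M (gr : nat -> set M) : Prop :=
  exists (I : choiceType) (S : I -> set M),
    (forall i, irreducible_admissible_submodule gr (S i)) /\
    direct_sum_decomposition S.

Definition voa_rational : Prop :=
  forall M (gr : nat -> set M), admissible_module gr -> completely_reducible gr.

Definition is_voa : Prop :=
  [/\ weak_module (adjoint V),
      forall u : V, vnth u (-1) (vac V) = u
        /\ forall n : nat, vnth u n%:Z (vac V) = 0,
      forall (m n : int) (v : V),
        Lvir m (Lvir n v) - Lvir n (Lvir m v)
        = (m - n)%:~R *: Lvir (m + n) v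
          + (if m + n == 0 then (m ^+ 3 - m)%:~R / 12%:R * ccharge V else 0) *: v,
      forall (u v : V) (n : int),
        vnth (Lvir (-1) u) n v = - n%:~R *: vnth u (n - 1) v
    & [/\ direct_sum_decomposition Vwt,
          forall n, fin_dim (Vwt n)
        & exists N : int, forall n, n < N -> Vwt n = [set 0]]].

Definition voa_ideal (I : set V) : Prop :=
  is_subspace I /\
  forall (u w : V) n, I w -> I (vnth u n w) /\ I (vnth w n u).

Definition voa_simple : Prop :=
  forall I, voa_ideal I -> I = [set 0] \/ I = [set: V].

Definition C2_cofinite : Prop :=
  fin_codim (lin_span [set w | exists u v : V, w = vnth u (-2) v]).

Definition CFT_type : Prop :=
  (forall n : int, n < 0 -> Vwt n = [set 0]) /\
  Vwt 0 = [set v | exists a : K, v = a *: vac V].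

(* V' = \bigoplus_n V_n^*, realised as the linear forms on V that vanish on all
   but finitely many V_n. *)
Definition restricted_dual (f : V -> K) : Prop :=
  linear (f : V -> K^o) /\
  exists N : nat, forall (n : int) (v : V), (N < `|n|)%N -> Vwt n v -> f v = 0.

(* For u of weight k, the coefficient of z^(-n-1) in
     < Y'(u, z) f, v > = < f, Y(e^(z L(1)) (- z^(-2))^(L(0)) u, z^(-1)) v >. *)
Definition contragredient_act (k : int) (u : V) (n : int) (f : V -> K) (v : V) : K :=
  \sum_(i \in [set: nat])
    ((-1) ^ k / (i`!)%:R) *
      f (vnth (iter i (Lvir 1) u) (2 * k - n - i%:Z - 2) v).

Definition self_contragredient : Prop :=
  exists phi : V -> V -> K,
    [/\ forall v, linear (fun u : V => phi u v : K^o),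
        injective phi,
        range phi = restricted_dual
      & forall (k n : int) (u v w : V), Vwt k u ->
          phi (vnth u n v) w = contragredient_act k u n (phi v) w].

(* The least conformal weight is taken for the order of K: over the complex
   numbers, x <= y means that y - x is a nonnegative real. *)
Definition effective_central_charge (ct : K) : Prop :=
  exists lmin : K,
    [/\ conformal_weight lmin,
        forall h, conformal_weight h -> lmin <= h
      & ct = ccharge V - 24%:R * lmin].

(* The formal series \sum_r (ch r) q^r: L(0) acts on V_n as the scalar n, so its
   coefficient at q^r is the dimension of the (r + c/24)-eigenspace of L(0). *)
Definition ch (r : K) : nat := dim (@wtspace (adjoint V) (r + ccharge V / 24%:R)).

End Modules.

Definition voa_isomorphic (K : numFieldType) (V W : voaData K) : Prop :=
  exists f : {linear V -> W},
    [/\ bijective f,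
        forall (u v : V) (n : int), f (vnth u n v) = vnth (f u) n (f v),
        f (vac V) = vac W & f (conf V) = conf W].


Definition pos_def_even_lattice (L : zmodType) (form : L -> L -> int) : Prop :=
  [/\ forall x y, form x y = form y x,
      forall x y z, form (x + y) z = form x z + form y z,
      forall x, (2 %| form x x)%Z
    & forall x, x != 0 -> 0 < form x x].

(* L = Z alpha is free of rank one on alpha; for a positive-definite L, which
   is torsion-free, it suffices that alpha != 0. *)
Definition rank_one_basis (L : zmodType) (alpha : L) : Prop :=
  alpha != 0 /\ forall x, exists n : int, x = alpha *~ n.

(* V_L = M(1) (x) C[L], where h = C (x) L is spanned by alpha and
   M(1) = S(h (x) t^-1 C[t^-1]) = C[alpha(-1), alpha(-2), ...]. The pair (mu, b)
   stands for the basis vector \prod_(j in mu) alpha(-(j+1)) (x) e^b.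
   As L is even of rank one, (b, c) is even for all b, c in L; hence the
   2-cocycle of the general construction is trivial and C[L] is the ordinary
   group algebra. *)
Section LatticeVOA.
Variables (K : numFieldType) (L : zmodType) (form : L -> L -> int) (alpha : L).

Definition lat_basis : choiceType := ({mset nat}%mset * L)%type.
Definition lat_space : lmodType K := {malg K[lat_basis]}.

Definition lat_vec (mu : {mset nat}%mset) (b : L) : lat_space :=
  mkmalgU ((mu, b) : lat_basis) (1 : K).

Definition lat_ext (f : lat_basis -> lat_space) (w : lat_space) : lat_space :=
  \sum_(x <- msupp w) mcoeff x w *: f x.

(* alpha(n); [alpha(m), alpha(n)] = m (alpha, alpha) delta_(m+n, 0) *)
Definition heis (n : int) : lat_space -> lat_space :=
  lat_ext (fun x => match n with
    | Negz j => lat_vec (x.1 `+` [mset j])%mset x.2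
    | Posz 0 => (form alpha x.2)%:~R *: lat_vec x.1 x.2
    | Posz j.+1 => ((j.+1)%:R * (form alpha alpha)%:~R * (x.1 j)%:R) *:
                     lat_vec (x.1 `\` [mset j])%mset x.2
    end).

(* In h, b is the multiple (b, alpha) / (alpha, alpha) of alpha. *)
Definition heis_of (b : L) (n : int) (w : lat_space) : lat_space :=
  ((form b alpha)%:~R / (form alpha alpha)%:~R) *: heis n w.

(* exp_coef A a is the coefficient of x^a in exp(\sum_(j >= 1) A_j x^j), and
   pow_coef A r a that in (\sum_(j >= 1) A_j x^j)^r. *)
Fixpoint pow_coef (A : nat -> lat_space -> lat_space) (r a : nat) (w : lat_space) :
    lat_space :=
  if r is r'.+1 then \sum_(1 <= j < a.+1) A j (pow_coef A r' (a - j)%N w)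
  else if a == 0%N then w else 0.

Definition exp_coef (A : nat -> lat_space -> lat_space) (a : nat) (w : lat_space) :
    lat_space :=
  \sum_(r < a.+1) ((r`!)%:R)^-1 *: pow_coef A r a w.

(* coefficient of z^a in exp(\sum_(j >= 1) b(-j) z^j / j) *)
Definition exp_creation (b : L) : nat -> lat_space -> lat_space :=
  exp_coef (fun j w => (j%:R)^-1 *: heis_of b (- j%:Z) w).

(* coefficient of z^(-a) in exp(- \sum_(j >= 1) b(j) z^(-j) / j) *)
Definition exp_annihilation (b : L) : nat -> lat_space -> lat_space :=
  exp_coef (fun j w => - (j%:R)^-1 *: heis_of b j%:Z w).

(* coefficient of z^(-n-1) in Y(e^b, z) =
     exp(\sum_(j >= 1) b(-j) z^j / j) exp(- \sum_(j >= 1) b(j) z^(-j) / j)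
     e^b z^(b(0)) *)
Definition exp_vop (b : L) (n : int) : lat_space -> lat_space :=
  lat_ext (fun x =>
    \sum_(i \in [set i : nat | 0 <= i%:Z - n - 1 - form b x.2])
       exp_creation b (absz (i%:Z - n - 1 - form b x.2)%R)
         (exp_annihilation b i (lat_vec x.1 (b + x.2)))).

(* coefficient of z^(-n-1) in Y(alpha(-(j_1+1)) ... alpha(-(j_r+1)) e^b, z), the
   normally ordered product of the fields (1/j!) (d/dz)^j alpha(z), j in s, and
   Y(e^b, z) *)
Fixpoint lat_vop (s : seq nat) (b : L) (n : int) (w : lat_space) : lat_space :=
  if s is j :: s' then
    \sum_(i \in [set: nat])
      'C(j + i, i)%:R *:
        (heis (- (j + i).+1%N%:Z) (lat_vop s' b (n + i%:Z) w)
         + (-1) ^+ j *: lat_vop s' b (n - (j + i).+1%N%:Z) (heis i%:Z w))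
  else exp_vop b n w.

Definition lattice_voa : voaData K := {|
  vcar := lat_space;
  vnth := fun u n w => \sum_(x <- msupp u) mcoeff x u *: lat_vop (enum_mset x.1) x.2 n w;
  vac := lat_vec mset0 0;
  conf := (2%:R * (form alpha alpha)%:~R)^-1 *: lat_vec (msetn 2%N 0%N) 0;
  ccharge := 1 |}.

End LatticeVOA.

(* Main.v *)
Require Import Defs.
From HB Require Import structures.
From mathcomp Require Import all_boot all_order all_algebra.
From mathcomp Require Import finmap multiset.
From mathcomp Require Import boolp classical_sets functions cardinality fsbigop reals.
From mathcomp Require Import complex monalg.
From mathcomp Require Import zify ring.

(* The equality of characters gives V_1 <> 0, and self-contragredience makes the form
   u_1 v on V_1 nondegenerate, so some h in V_1 generates a Heisenberg algebra with the same
   normalisation as alpha in V_L. Over this algebra both V and V_L are free on their vacuum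
   spaces, so the characters force the vacuum space Omega of V to have, in weight n, as many
   dimensions as L has vectors of norm 2 n, that is, solutions m of n = k m^2 where
   (alpha, alpha) = 2 k. The difference w of the conformal vector and the Sugawara vector of h
   lies in Omega_2 and L(-1) w in Omega_3; one of these spaces vanishes, which forces w = 0.
   Hence L(0) = h(0)^2 / 4 k on Omega, which splits into sectors Omega^m where h(0) = 2 k m.

   For u in Omega^a and v in Omega^b the series Y(u, z) v starts with a vector u * v of
   Omega^(a+b), and * is associative and commutative. The contragredient form provides
   e in Omega^1 and f in Omega^-1 with e * f = 1, so every Omega^m is spanned by the m-th
   power of e. Sending e^(m alpha) to that power intertwines the Heisenberg actions, and
   the L(-1)-derivative property, which now reads d/dz Y(u, z) = a :h(z) Y(u, z): for u in
   Omega^a, identifies the vertex operators with those of V_L. *)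
Set Implicit Arguments.
Unset Strict Implicit.
Unset Printing Implicit Defensive.
Import Order.TTheory GRing.Theory Num.Theory.
Local Open Scope classical_set_scope.
Local Open Scope ring_scope.

(** * Finite-dimensional subspaces *)

(** The comparison map runs from V_L to V. Since V_L is given by formulas on a monomial basis, a
    linear map out of it may be prescribed freely, and each identity between vertex operators is
    tested in V, where the Borcherds identity is at hand. Once this map is known to be injective,
    the Heisenberg relations of V_L are pulled back along it. Operator exponentials are handled
    through their coefficients [E_a], by the recursion [a E_a = \sum_j j A_j E_(a-j)]. In
    characteristic 0 it determines them, and the derivative property of V delivers exactly this
    recursion for the coefficients of Y(u, z) v. One obstacle shapes the construction of e and f:
    the partner that the contragredient form assigns to a vector of [Omega^1] is merely some vector
    of weight k, neither a vacuum vector nor of definite charge. Applying h(0) to the pairing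
    extracts the component needed, because h(0) vanishes on all weights below k. *)

Section FiniteSupportSums.
Variables (M : zmodType).

Lemma fsbig_nat_ord (F : nat -> M) (n : nat) :
  (forall i, (n <= i)%N -> F i = 0) ->
  \sum_(i \in [set: nat]) F i = \sum_(i < n) F i.
Proof.
move=> F0; rewrite (fsbig_ord _ _ F); apply/esym/fsbig_widen => // i [_ /= ].
by case: (ltnP i n) => // le_ni _; rewrite F0.
Qed.

Lemma fsbig_nat_cond (F : nat -> M) (P : pred nat) (n : nat) :
  (forall i, (n <= i)%N -> P i -> F i = 0) ->
  \sum_(i \in [set i : nat | P i]) F i = \sum_(i < n | P i) F i.
Proof.
move=> F0; rewrite fsbig_mkcond (@fsbig_nat_ord _ n) /=.
  rewrite [RHS]big_mkcond; apply: eq_bigr => i _ /=.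
  rewrite /patch; case: ifPn => [/set_mem /= -> //|].
  by case: ifP => // Pi /negP[]; apply/mem_set.
move=> i le_ni; rewrite /patch; case: ifP => // /set_mem /= Pi; exact: F0.
Qed.

End FiniteSupportSums.

(** Injectivity makes the supports of [F] and [f \o F] agree. Otherwise an infinite support, on
    which the sum is 0 by convention, could become finite under [f]. *)
Lemma raddf_fsbig (M M' : zmodType) (f : {additive M -> M'}) (I : choiceType)
    (A : set I) (F : I -> M) : injective f ->
  f (\sum_(i \in A) F i) = \sum_(i \in A) f (F i).
Proof.
move=> f_inj; rewrite raddf_sum; congr bigop.body; rewrite /finite_support !unlock.
congr (fset_set (_ `&` _)); apply/seteqP; split => i /= F0 //.
  by move=> /eqP; rewrite raddf_eq0 // => /eqP.
by move=> Fi0; apply: F0; rewrite Fi0 raddf0.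
Qed.

Section Dimension.
Variables (K : numFieldType) (M : lmodType K).
Implicit Types (S T : set M).

Definition free_fam n (b : 'I_n -> M) :=
  forall a : 'I_n -> K, \sum_i a i *: b i = 0 -> forall i, a i = 0.

Lemma subspace_sum S (I : Type) (r : seq I) (P : pred I) (F : I -> M) :
  is_subspace S -> (forall i, P i -> S (F i)) -> S (\sum_(i <- r | P i) F i).
Proof.
move=> [S0 SD] SF; elim/big_ind: _ => // x y Sx Sy.
by rewrite -[x]scale1r; apply: SD.
Qed.

Lemma subspaceZ S a u : is_subspace S -> S u -> S (a *: u).
Proof. by move=> [S0 SD] Su; rewrite -[_ *: _]addr0; apply: SD. Qed.

Lemma subspaceD S u v : is_subspace S -> S u -> S v -> S (u + v).
Proof. by move=> [S0 SD] Su Sv; rewrite -[u]scale1r; apply: SD. Qed.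

Lemma subspaceB S u v : is_subspace S -> S u -> S v -> S (u - v).
Proof. by move=> SS Su Sv; apply: subspaceD => //; rewrite -scaleN1r; apply: subspaceZ. Qed.

Lemma has_dimP S n : has_dim S n <-> exists b : 'I_n -> M,
  [/\ forall i, S (b i), free_fam b &
      forall v, S v -> exists a : 'I_n -> K, v = \sum_i a i *: b i].
Proof.
split=> [[b [Sb bP]]|[b [Sb b_free b_gen]]].
  exists b; split=> // [a a0|v /bP[a [-> _]]]; last by exists a.
  case: n b Sb bP a a0 => [|n] b Sb bP a a0; first by case.
  have /bP[a' [ea' ua']] := Sb ord0.
  (* Adding a relation to the coordinates of [b ord0] gives coordinates of the same vector, so
     uniqueness makes the relation trivial. *)
  have /(ua' _) E : b ord0 = \sum_i [ffun i => a' i + a i] i *: b i.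
    under eq_bigr do rewrite ffunE scalerDl.
    by rewrite big_split /= -ea' a0 addr0.
  move=> i; move/ffunP/(_ i): E; rewrite ffunE -[LHS]addr0.
  by move/addrI.
exists b; split=> // v Sv; have [a ea] := b_gen v Sv.
exists [ffun i => a i]; split; first by rewrite ea; apply: eq_bigr => i _; rewrite ffunE.
move=> a' ea'; apply/ffunP => i; rewrite ffunE.
apply/eqP; rewrite -subr_eq0; apply/eqP.
apply: (b_free (fun i => a i - a' i)) => {i}.
under eq_bigr do rewrite scalerBl.
by rewrite sumrB -ea -ea' subrr.
Qed.

Lemma free_fam_leq n m (b : 'I_n -> M) (c : 'I_m -> M) (A : 'M[K]_(m, n)) :
  free_fam c -> (forall i, c i = \sum_j A i j *: b j) -> (m <= n)%N.
Proof.
move=> c_free cE; suff: row_free A by move/eqP <-; apply: rank_leq_col.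
apply: inj_row_free => u uA0; apply/rowP => i; rewrite mxE.
apply: (c_free (fun i => u 0 i)).
under eq_bigr do rewrite cE scaler_sumr.
rewrite exchange_big big1 //= => j _.
under eq_bigr do rewrite scalerA.
by rewrite -scaler_suml; move/rowP/(_ j): uA0; rewrite !mxE => ->; rewrite scale0r.
Qed.

Lemma has_dim_free_leq S n m (c : 'I_m -> M) :
  has_dim S n -> (forall i, S (c i)) -> free_fam c -> (m <= n)%N.
Proof.
move=> /has_dimP[b [_ _ b_gen]] Sc c_free.
have /choice[A AE] i := b_gen _ (Sc i).
apply: (@free_fam_leq _ _ b c (\matrix_(i, j) A i j)) => // i.
by rewrite AE; apply: eq_bigr => j _; rewrite mxE.
Qed.

Lemma has_dim_uniq S n m : has_dim S n -> has_dim S m -> n = m.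
Proof.
move=> dn dm; have /has_dimP[b [Sb bf _]] := dn; have /has_dimP[c [Sc cf _]] := dm.
by apply/eqP; rewrite eqn_leq (has_dim_free_leq dm Sb bf) (has_dim_free_leq dn Sc cf).
Qed.

Lemma has_dim_dim S n : has_dim S n -> Defs.dim S = n.
Proof.
move=> dn; rewrite /Defs.dim; case: xgetP => [m _ /= dm|/(_ n)//].
exact: has_dim_uniq dm dn.
Qed.

Lemma fin_dim_dim S : fin_dim S -> has_dim S (Defs.dim S).
Proof. by move=> [n dn]; rewrite (has_dim_dim dn). Qed.

(** A free family of maximal size in [T], bounded by the dimension of [S], spans [T]: a vector
    outside its span would lengthen it. *)
Lemma fin_dim_sub S T : is_subspace T -> T `<=` S -> fin_dim S -> fin_dim T.
Proof.
move=> TT TS [n dn].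
pose P m := `[< exists c : 'I_m -> M, (forall i, T (c i)) /\ free_fam c >].
have P0 : exists m, P m.
  by exists 0%N; apply/asboolP; exists (fun=> 0); split=> [[]//|a _ []].
have Pn m : P m -> (m <= n)%N.
  by move=> /asboolP[c [Tc cf]]; apply: (has_dim_free_leq dn) cf => i; apply/TS.
case: (ex_maxnP P0 Pn) => m /asboolP[c [Tc cf]] maxm.
exists m; apply/has_dimP; exists c; split=> // v Tv; apply/not_existsP => nv.
suff /maxm : P m.+1 by rewrite ltnn.
apply/asboolP; exists (fun i => if unlift ord0 i is Some j then c j else v); split.
  by move=> i; case: unliftP.
move=> a; rewrite big_ord_recl unlift_none => a0.
have {}a0 : a ord0 *: v = - \sum_i a (lift ord0 i) *: c i.
  apply/eqP; rewrite -addr_eq0 -{2}a0; apply/eqP; congr (_ + _).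
  by apply: eq_bigr => i _; rewrite liftK.
have [z|nz] := eqVneq (a ord0) 0.
  move: a0; rewrite z scale0r => /eqP; rewrite eq_sym oppr_eq0 => /eqP /cf cz i.
  by case: (unliftP ord0 i) => [j|] ->.
case: (nv (fun i => - (a ord0)^-1 * a (lift ord0 i))).
rewrite -[LHS]scale1r -(mulVf nz) -scalerA a0 scalerN scaler_sumr -sumrN.
by apply: eq_bigr => i _; rewrite scalerA mulNr scaleNr.
Qed.

Lemma has_dim_seq (T : eqType) (X : seq T) (v : T -> M) S : uniq X ->
  {in X, forall x, S (v x)} ->
  (forall u, S u -> exists a : T -> K, u = \sum_(x <- X) a x *: v x) ->
  (forall a : T -> K, \sum_(x <- X) a x *: v x = 0 -> {in X, forall x, a x = 0}) ->
  has_dim S (size X).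
Proof.
case: X => [|x0 X'] X_uniq Sv v_gen v_free.
  apply/has_dimP; exists (fun=> 0); split=> [[]//|a _ []//|u /v_gen[a ->]].
  by exists (fun=> 0); rewrite big_nil big_ord0.
set X := x0 :: X' in X_uniq Sv v_gen v_free *; apply/has_dimP.
exists (fun i : 'I_(size X) => v (nth x0 X i)); split=> [i|a|u /v_gen[a ->]].
- by apply: Sv; rewrite mem_nth.
- move=> a0 i.
  pose b x := if insub (index x X) is Some j then a j else 0.
  have bE (j : 'I_(size X)) : b (nth x0 X j) = a j.
    by rewrite /b index_uniq // valK.
  rewrite -bE; apply: v_free; last by rewrite mem_nth.
  rewrite (big_nth x0) big_mkord -[RHS]a0; apply: eq_bigr => j _.
  by rewrite bE.
by exists (fun i => a (nth x0 X i)); rewrite (big_nth x0) big_mkord.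
Qed.

End Dimension.

(** * Free modules and partitions *)

Section LinearExtension.
Variables (K : numFieldType) (I : choiceType) (T : lmodType K) (g : I -> T).

Definition malg_ext (w : {malg K[I]}) : T := \sum_(x <- msupp w) mcoeff x w *: g x.

Lemma malg_extEw (w : {malg K[I]}) (d : {fset I}) : (msupp w `<=` d)%fset ->
  malg_ext w = \sum_(x <- d) mcoeff x w *: g x.
Proof.
move=> le; rewrite /malg_ext; apply: big_fset_incl => // x _ /mcoeff_outdom ->.
by rewrite scale0r.
Qed.

Fact malg_ext_linear : linear malg_ext.
Proof.
move=> a u v.
pose d := (msupp (a *: u + v) `|` (msupp u `|` msupp v))%fset.
rewrite !(@malg_extEw _ d) /d ?fsubsetUl //.
- rewrite scaler_sumr -big_split /=; apply: eq_bigr => x _.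
  by rewrite mcoeffD mcoeffZ scalerDl scalerA.
- by apply: fsubset_trans (fsubsetUr _ _); apply: fsubsetUr.
- by apply: fsubset_trans (fsubsetUr _ _); apply: fsubsetUl.
Qed.

HB.instance Definition _ :=
  GRing.isLinear.Build K {malg K[I]} T _ malg_ext malg_ext_linear.

Lemma malg_extU x : malg_ext (mkmalgU x 1) = g x.
Proof.
rewrite (@malg_extEw _ [fset x]%fset) ?msuppU_le //.
by rewrite big_seq_fset1 mcoeffUU scale1r.
Qed.

Lemma malgE (w : {malg K[I]}) : w = \sum_(x <- msupp w) mcoeff x w *: mkmalgU x 1.
Proof.
rewrite {1}[w]monalgE; apply: eq_bigr => x _; apply/malgP => y.
by rewrite mcoeffZ !mcoeffU; case: eqP => _; rewrite ?mulr1 ?mulr0.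
Qed.

End LinearExtension.

Lemma mcoeff_sumU (K : numFieldType) (I : choiceType) (X : seq I) (a : I -> K) y : uniq X ->
  mcoeff y (\sum_(x <- X) a x *: (mkmalgU x 1 : {malg K[I]})) = if y \in X then a y else 0.
Proof.
move=> X_uniq; rewrite raddf_sum; case: ifPn => yX.
  rewrite (bigD1_seq y) //= mcoeffZ mcoeffU eqxx mulr1 big1 ?addr0 // => x /negPf xy.
  by rewrite mcoeffZ mcoeffU xy mulr0.
rewrite big_seq big1 //= => x xX; rewrite mcoeffZ mcoeffU; case: eqP => [e|_]; last exact: mulr0.
by rewrite -e xX in yX.
Qed.

Lemma malg_linearP (K : numFieldType) (I : choiceType) (T : lmodType K)
    (f g : {linear {malg K[I]} -> T}) :
  (forall x, f (mkmalgU x 1) = g (mkmalgU x 1)) -> f =1 g.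
Proof.
move=> fg w; rewrite [w]malgE !linear_sum; apply: eq_bigr => x _.
by rewrite !linearZ_LR fg.
Qed.

Section MultisetWeight.
Implicit Types (m : {mset nat}%mset).

(* A multiset of natural numbers j stands for the partition with parts j + 1. *)
Definition mwt m : nat := (\sum_(j <- m) j.+1)%N.

Lemma perm_msetD1 j m : perm_eq (j +` m)%mset (j :: m).
Proof. by rewrite -{1}[m]seq_mset_id -mset_cons perm_eq_seq_mset. Qed.

Lemma mwt0 : mwt mset0 = 0%N.
Proof. by rewrite /mwt enum_mset0 big_nil. Qed.

Lemma mwtD1 j m : mwt (j +` m)%mset = (j.+1 + mwt m)%N.
Proof. by rewrite /mwt (perm_big _ (perm_msetD1 j m)) big_cons. Qed.

Lemma mset_ind (P : {mset nat}%mset -> Prop) :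
  P mset0 -> (forall j m, P m -> P (j +` m)%mset) -> forall m, P m.
Proof.
move=> P0 PS m; elim/ltn_ind: {m}(mwt m) {-2}m (erefl (mwt m)) => n IH m mn.
have [->//|/eqP m0] := eqVneq m mset0.
have [j jm] : exists j, j \in m.
  apply: contrapT => /forallNP nj; apply: m0; apply/msetP => j.
  by rewrite mset0E; apply/mset_eq0P/negP.
rewrite -(msetB1K jm); apply/PS/(IH _ _ _ erefl).
by have := mwtD1 j (m `\ j)%mset; rewrite (msetB1K jm); lia.
Qed.

(** A deliberate overcount: every partition of weight at most [n] occurs, possibly repeated and
    along with heavier ones; [parts] filters the list. *)
Fixpoint mset_upto n : seq {mset nat}%mset :=
  if n is n'.+1 then mset0 :: [seq (j +` m)%mset | j <- iota 0 n, m <- mset_upto n']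
  else [:: mset0].

Lemma mem_mset_upto n m : (mwt m <= n)%N -> m \in mset_upto n.
Proof.
elim: n m => [|n IH]; elim/mset_ind => [|j m _]; rewrite ?mwtD1 ?inE ?eqxx //.
move=> le; apply/orP; right; apply: allpairs_f; first by rewrite mem_iota; lia.
by apply: IH; lia.
Qed.

Definition parts n := undup [seq m <- mset_upto n | mwt m == n].

Lemma mem_parts n m : (m \in parts n) = (mwt m == n).
Proof.
rewrite mem_undup mem_filter; case: eqP => //= <-.
by rewrite mem_mset_upto.
Qed.

Lemma size_parts0 : size (parts 0) = 1%N.
Proof. by rewrite /parts /= mwt0 eqxx. Qed.

End MultisetWeight.

Section FockIndices.
Variables (I : choiceType) (lv : I -> nat) (B : nat -> seq I).
Hypothesis B_uniq : forall n, uniq (B n).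
Hypothesis mem_B : forall n i, (i \in B n) = (lv i == n).

Fixpoint lvl_upto n := if n is n'.+1 then lvl_upto n' ++ B n else B 0.

Lemma mem_lvl_upto n i : (i \in lvl_upto n) = (lv i <= n)%N.
Proof.
elim: n => [|n IH] /=; first by rewrite mem_B leqn0.
by rewrite mem_cat IH mem_B [in RHS]leq_eqVlt ltnS orbC.
Qed.

Lemma lvl_upto_uniq n : uniq (lvl_upto n).
Proof.
elim: n => [|n IH] //=; rewrite cat_uniq IH B_uniq andbT /=; apply/hasPn => i.
by rewrite mem_B mem_lvl_upto => /eqP ->; rewrite ltnn.
Qed.

Definition fock_idx n : seq ({mset nat}%mset * I)%type :=
  [seq (m, i) | i <- lvl_upto n, m <- parts (n - lv i)%N].

Lemma fock_idx_uniq n : uniq (fock_idx n).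
Proof.
apply: allpairs_uniq_dep => [|i _|[i m] [i' m'] _ _ /= [-> ->] //].
  exact: lvl_upto_uniq.
exact: undup_uniq.
Qed.

Lemma mem_fock_idx n x : (x \in fock_idx n) = (mwt x.1 + lv x.2 == n)%N.
Proof.
apply/allpairsPdep/eqP => [[i [m [+ + ->]]] /=|<-].
  by rewrite mem_lvl_upto mem_parts => le /eqP ->; rewrite subnK.
by exists x.2, x.1; rewrite mem_lvl_upto leq_addl mem_parts addnK eqxx; case: (x).
Qed.

Lemma size_fock_idx n :
  size (fock_idx n) = (\sum_(j < n.+1) size (parts (n - j)) * size (B j))%N.
Proof.
rewrite size_allpairs_dep sumnE big_map.
have H k : (\sum_(i <- lvl_upto k) size (parts (n - lv i)) =
   \sum_(j < k.+1) size (parts (n - j)) * size (B j))%N.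
  have HB j : (\sum_(i <- B j) size (parts (n - lv i)) =
               size (parts (n - j)) * size (B j))%N.
    rewrite -[size (B j)]sum1_size big_distrr /= big_seq [RHS]big_seq; apply: eq_bigr => i.
    by rewrite mem_B muln1 => /eqP ->.
  elim: k => [|k IH] /=; first by rewrite big_ord_recl big_ord0 addn0 HB.
  by rewrite big_cat IH [in RHS]big_ord_recr /= HB.
exact: H.
Qed.

End FockIndices.

(** The power series with coefficients [p] has constant term 1, so it can be cancelled from a
    product. *)
Lemma fock_count_inj (p f g : nat -> nat) : p 0%N = 1%N ->
  (forall n, \sum_(j < n.+1) p (n - j)%N * f j = \sum_(j < n.+1) p (n - j)%N * g j)%N ->
  forall n, f n = g n.
Proof.
move=> p0 fg; elim/ltn_ind => n IH; have := fg n.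
rewrite !big_ord_recr /= subnn p0 !mul1n.
by under eq_bigr => j _ do rewrite IH //; move/addnI.
Qed.

(** * Modules over the Heisenberg algebra *)

Section HeisenbergModule.
Variables (K : numFieldType) (V : lmodType K) (h : int -> {linear V -> V}) (N : K).
Hypothesis N_neq0 : N != 0.
Hypothesis h_comm : forall m n v,
  h m (h n v) - h n (h m v) = (if m + n == 0 then m%:~R * N else 0) *: v.
Implicit Types (v w : V) (j : nat) (s : seq nat).

Definition hvac : set V := [set v | forall j : nat, h j.+1%:Z v = 0].

Definition creation s v := foldr (fun j : nat => h (- j.+1%:Z)) v s.

Lemma hvac_subspace : is_subspace hvac.
Proof.
split=> [j|a u v u0 v0 j]; first exact: raddf0.
by rewrite linearP u0 v0 scaler0 addr0.
Qed.

Lemma h_swap m n v : m + n != 0 -> h m (h n v) = h n (h m v).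
Proof.
by move=> /negPf mn0; apply/eqP; rewrite -subr_eq0 h_comm mn0 scale0r.
Qed.

Lemma creation_rem s j v : j \in s ->
  creation s v = h (- j.+1%:Z) (creation (rem j s) v).
Proof.
elim: s => [|i s IH] //=; rewrite in_cons; case: (eqVneq i j) => [->|ne] //=.
by move=> /IH ->; rewrite h_swap //; lia.
Qed.

Lemma perm_creation s s' v : perm_eq s s' -> creation s v = creation s' v.
Proof.
elim: s s' => [|j s IH] s' pss'.
  by move: pss'; rewrite perm_sym => /perm_nilP ->.
have js' : j \in s' by rewrite -(perm_mem pss') mem_head.
rewrite (creation_rem _ js') /=; congr (h _ _); apply: IH.
by rewrite -(perm_cons j) (perm_trans pss') // perm_to_rem.
Qed.

Lemma h0_creation (mu : K) s v : h 0 v = mu *: v -> h 0 (creation s v) = mu *: creation s v.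
Proof.
move=> h0v; elim: s => [|j s IH] //=.
by rewrite h_swap ?oppr_eq0 //= ?add0r // IH linearZ.
Qed.

(** Over a vacuum vector, with [h (-(j+1))] read as a variable x_j, the operator [h (j+1)] is
    [(j+1) N d/dx_j]. *)
Lemma hpos_creation j s v : hvac v -> h j.+1%:Z (creation s v) =
  (j.+1%:R * N * (count_mem j s)%:R) *: creation (rem j s) v.
Proof.
move=> hv; elim: s => [|i s IH] /=; first by rewrite hv mulr0 scale0r.
have := h_comm j.+1%:Z (- i.+1%:Z) (creation s v).
move/eqP; rewrite subr_eq => /eqP ->; rewrite subr_eq0 eqz_nat eqSS eq_sym IH.
have [->|ne] := eqVneq i j; last by rewrite scale0r add0r add0n linearZ.
rewrite linearZ /= natrD mulrDr scalerDl mulr1; congr (_ + _).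
have [js|/count_memPn ->] := boolP (j \in s); last by rewrite !mulr0 !scale0r.
by rewrite -creation_rem.
Qed.

(** The Weyl relation [D, X^r] = r c X^(r-1) on an arbitrary vector. The truncated predecessor at r
    = 0 is harmless because its coefficient is 0. *)
Lemma hpos_pow j r v : h j.+1%:Z (iter r (h (- j.+1%:Z)) v) =
  iter r (h (- j.+1%:Z)) (h j.+1%:Z v) +
  (r%:R * (j.+1%:R * N)) *: iter r.-1 (h (- j.+1%:Z)) v.
Proof.
elim: r => [|r IH]; first by rewrite /= mul0r scale0r addr0.
have := h_comm j.+1%:Z (- j.+1%:Z) (iter r (h (- j.+1%:Z)) v).
move/eqP; rewrite subrr eqxx subr_eq => /eqP; rewrite -!iterS => ->.
rewrite IH raddfD /= linearZ /= addrCA; congr (_ + _).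
case: r {IH} => [|r] /=; first by rewrite mul0r scale0r addr0 mul1r.
by rewrite -scalerDl; congr (_ *: _); rewrite -[r.+2%:R]natr1; ring.
Qed.

(** * Generation of a graded module, bounded below, by its vacuum vectors *)

Section Graded.
Variable Vg : int -> set V.
Hypothesis Vg_subspace : forall n, is_subspace (Vg n).
Hypothesis Vg_h : forall n m v, Vg n v -> Vg (n - m) (h m v).
Hypothesis Vg_neg : forall n v, n < 0 -> Vg n v -> v = 0.

Lemma Vg_iter n m r v : Vg n v -> Vg (n - m * r%:Z) (iter r (h m) v).
Proof.
move=> Vv; elim: r => [|r IH]; first by rewrite mulr0 subr0.
have := Vg_h m IH; rewrite iterS; congr (Vg _ _); lia.
Qed.

Lemma Vg_creation n s v : Vg n v -> Vg (n + (\sum_(j <- s) j.+1)%N%:Z) (creation s v).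
Proof.
move=> Vv; elim: s => [|j s IH] /=; first by rewrite big_nil addr0.
rewrite big_cons; have := Vg_h (- j.+1%:Z) IH; congr (Vg _ _); lia.
Qed.

(** For D = [h (j+1)], X = [h (-(j+1))] and [D, X] = c, the sum of (-1)^i X^i D^i v / (i! c^i) over
    i is killed by D. The vector [w] is chosen so that this sum is v - X w. *)
Lemma cancel_mode n j v : Vg n v -> exists w,
  [/\ Vg (n - j.+1%:Z) w, h j.+1%:Z (v - h (- j.+1%:Z) w) = 0 &
      forall i, i != j -> h i.+1%:Z v = 0 -> h i.+1%:Z w = 0].
Proof.
(* [r] exceeds the weight [n], so D^r v has negative weight and vanishes; the series may stop
   there. *)
move=> Vv; have [r rE] : exists r, r = `|n|.+1 by exists `|n|.+1.
pose c := j.+1%:R * N.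
pose D := h j.+1%:Z; pose X := h (- j.+1%:Z).
have c0 : c != 0 by rewrite mulf_neq0 // pnatr_eq0.
pose F (i : nat) := ((-1) ^+ i / (i`!%:R * c ^+ i)) *: iter i X (iter i.+1 D v).
pose w := \sum_(i < r) ((-1) ^+ i / (i.+1`!%:R * c ^+ i.+1)) *: iter i X (iter i.+1 D v).
exists w; split.
- apply: subspace_sum => // i _; apply: subspaceZ => //.
  have := Vg_iter (- j.+1%:Z) i (Vg_iter j.+1%:Z i.+1 Vv).
  congr (Vg _ _); lia.
- rewrite raddfB /=; apply/eqP; rewrite subr_eq0; apply/eqP.
  (* The two terms that the Weyl relation yields for each summand are consecutive values of [F], so
     the sum telescopes. *)
  have DXw : D (X w) = \sum_(0 <= i < r) (F i - F i.+1).
    rewrite big_mkord !raddf_sum /=; apply: eq_bigr => i _.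
    rewrite !linearZ /= -iterS hpos_pow /= scalerDr addrC scalerA.
    congr (_ + _).
      rewrite /F; congr (_ *: _); rewrite factS.
      rewrite natrM -/c exprS.
      have f0 : (i`!%:R : K) != 0 by rewrite pnatr_eq0 -lt0n fact_gt0.
      have i0 : (i.+1%:R : K) != 0 by rewrite pnatr_eq0.
      have ci0 : c ^+ i != 0 by rewrite expf_neq0.
      move: f0 i0 ci0 c0; move: (i`!%:R : K) (i.+1%:R : K) (c ^+ i) => a b d.
      move: ((-1) ^+ i) (c) => e c' a0 b0 d0 c0.
      by field; rewrite ?a0 ?b0 ?c0 ?d0.
    by rewrite scalerN -scaleNr [(-1) ^+ i.+1]exprS mulN1r mulNr opprK.
  have tele : \sum_(0 <= i < r) (F i - F i.+1) = F 0%N - F r.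
    rewrite -[LHS]opprK -sumrN; under eq_bigr do rewrite opprB.
    by rewrite telescope_sumr // opprB.
  rewrite -/D -/X DXw tele /F /= (_ : D (iter r D v) = 0).
    rewrite (_ : iter r X 0 = 0) ?scaler0 ?subr0 ?expr0 ?mulr1 ?invr1 ?mulr1 ?scale1r //.
    by elim: (r) => //= r' ->; rewrite raddf0.
  rewrite -iterS; apply: (@Vg_neg _ _ _ (Vg_iter _ _ Vv)).
  rewrite rE; nia.
move=> i ne hiv; rewrite linear_sum big1 // => p _; rewrite linearZ_LR /=.
have H m q u : i.+1%:Z + m != 0 -> h i.+1%:Z u = 0 -> h i.+1%:Z (iter q (h m) u) = 0.
  by move=> im hu; elim: q => [|q IH] //=; rewrite h_swap // IH raddf0.
by rewrite -iterS !H ?scaler0 //; lia.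
Qed.

(** The positive modes are killed one at a time. The last clause of [cancel_mode] preserves those
    already killed, and modes beyond the weight of [v] act as 0. *)
Lemma hvac_approx n v : Vg n v -> exists (w : V) (s : nat -> V) (r : nat),
  [/\ hvac w, Vg n w, forall j, Vg (n - j.+1%:Z) (s j) &
      v = w + \sum_(j < r) h (- j.+1%:Z) (s j)].
Proof.
move=> Vv.
have H r : exists w (s : nat -> V), [/\ forall j, (j < r)%N -> h j.+1%:Z w = 0, Vg n w,
    forall j, Vg (n - j.+1%:Z) (s j) & v = w + \sum_(j < r) h (- j.+1%:Z) (s j)].
  elim: r => [|r [w [s [hw Vw Vs ev]]]].
    exists v, (fun=> 0); split=> // [j|]; first by case: (Vg_subspace (n - j.+1%:Z)).
    by rewrite big_ord0 addr0.
  have [u [Vu hu hu']] := cancel_mode r Vw.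
  exists (w - h (- r.+1%:Z) u), (fun j => if j == r then u else s j); split.
  - move=> j; rewrite ltnS leq_eqVlt => /orP[/eqP -> //|jr].
    rewrite raddfB /= hw // h_swap; last lia.
    by rewrite hu' ?raddf0 ?addr0 ?hw // neq_ltn jr.
  - apply: subspaceB => //.
    by have := Vg_h (- r.+1%:Z) Vu; congr (Vg _ _); lia.
  - by move=> j; case: eqP => // ->.
  rewrite big_ord_recr /= eqxx (eq_bigr (fun j : 'I_r => h (- j.+1%:Z) (s j))); last first.
    by move=> i _; rewrite ltn_eqF.
  by rewrite addrACA addNr addr0.
have [w [s [hw Vw Vs ev]]] := H `|n|.+1.
exists w, s, `|n|.+1; split=> // j; case: (ltnP j `|n|.+1) => [/hw//|le].
by apply: Vg_neg (Vg_h _ Vw); lia.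
Qed.

(** Induction on the weight: the vectors [s j] of [hvac_approx] have smaller weight than [v]. *)
Lemma hvac_ind (W : int -> set V) : (forall n, is_subspace (W n)) ->
  (forall n v, Vg n v -> hvac v -> W n v) ->
  (forall n j v, Vg n v -> W n v -> W (n + j.+1%:Z) (h (- j.+1%:Z) v)) ->
  forall n v, Vg n v -> W n v.
Proof.
move=> W_sub W_vac W_h n v.
have [n0|n0] := ltP n 0.
  by move=> /(Vg_neg n0) ->; case: (W_sub n).
case: n n0 => // n _; elim/ltn_ind: n v => n IH v Vv.
have [w [s [r [hw Vw Vs ->]]]] := hvac_approx Vv.
apply: subspaceD (W_vac _ _ Vw hw) _ => //; apply: subspace_sum => // j _.
rewrite -[n%:Z](subrK j.+1%:Z); apply: (W_h) => //.
have [le|lt] := ltnP j n; last first.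
  by rewrite (Vg_neg _ (Vs j)); [case: (W_sub (n%:Z - j.+1%:Z)) | lia].
by have := Vs j; rewrite subzn // => Vsj; apply: IH => //; lia.
Qed.

End Graded.

(** * Freeness of Fock monomials over independent vacuum vectors *)

Section Monomials.
Variables (I : choiceType) (beta : I -> V).
Local Notation fock := {malg K[({mset nat}%mset * I)%type]}.
Hypothesis beta_vac : forall i, hvac (beta i).

Definition fock_map : {linear fock -> V} :=
  malg_ext (fun x : {mset nat}%mset * I => creation (enum_mset x.1) (beta x.2)).

Lemma fock_mapU (m : {mset nat}%mset) i : fock_map (mkmalgU (m, i) 1) = creation m (beta i).
Proof. by rewrite /= malg_extU. Qed.

Definition free_family := forall (a : I -> K) (X : seq I), uniq X ->
  \sum_(i <- X) a i *: beta i = 0 -> {in X, forall i, a i = 0}.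

Hypothesis beta_free : free_family.

Let diff j : {linear fock -> _} :=
  malg_ext (fun x : {mset nat}%mset * I =>
    (x.1 j)%:R *: (mkmalgU ((x.1 `\ j)%mset, x.2) 1 : fock)).

Let fock_diff j (w : fock) : h j.+1%:Z (fock_map w) = (j.+1%:R * N) *: fock_map (diff j w).
Proof.
pose F : {linear fock -> V} := h j.+1%:Z \o fock_map.
pose G : {linear fock -> V} := ((j.+1%:R * N) \*: (fock_map \o diff j)).
suff FG (m : {mset nat}%mset) i : F (mkmalgU (m, i) 1) = G (mkmalgU (m, i) 1).
  by apply: (malg_linearP (f := F) (g := G)) => -[m i]; exact: FG.
rewrite /= !malg_extU linearZ_LR /= malg_extU /= hpos_creation //.
rewrite !scalerA count_mem_mset.
have [jm|/mset_eq0P ->] := boolP (j \in m); last by rewrite !mulr0 !scale0r.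
rewrite (_ : creation (rem j m) _ = creation (m `\ j)%mset (beta i)).
  by congr (_ *: _); ring.
apply: perm_creation; rewrite -(perm_cons j) perm_sym.
apply: perm_trans (perm_to_rem jm); rewrite perm_sym -{1}(msetB1K jm).
exact: perm_msetD1.
Qed.

Let diff_coeff j (m : {mset nat}%mset) i (w : fock) :
  mcoeff (m, i) (diff j w) = (m j).+1%:R * mcoeff ((j +` m)%mset, i) w.
Proof.
rewrite /diff /= /malg_ext raddf_sum [in RHS](malgE w) raddf_sum mulr_sumr /=.
suff E (m' : {mset nat}%mset) i' :
    (m' j)%:R * (((m' `\ j)%mset, i') == (m, i))%:R =
    (m j).+1%:R * ((m', i') == ((j +` m)%mset, i))%:R :> K.
  apply: eq_bigr => -[m' i'] _; rewrite !mcoeffZ !mcoeffU [RHS]mulrCA; congr (_ * _).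
  exact: E.
rewrite !xpair_eqE; have [jm'|/mset_eq0P jm'] := boolP (j \in m'); last first.
  rewrite jm' mul0r; case: eqP => [e|_]; last by rewrite mulr0.
  by move: jm'; rewrite e mset1DE eqxx.
have -> : ((m' `\ j)%mset == m) = (m' == (j +` m)%mset).
  by apply/eqP/eqP => [<-|->]; rewrite ?msetB1K ?msetD1K.
case: eqP => [->|_]; last by rewrite !mulr0.
by rewrite mset1DE eqxx add1n.
Qed.

(** By [fock_diff] the kernel is stable under all partial derivatives [diff j], which lower the
    weight. By induction these derivatives vanish on a kernel element, which is therefore a
    combination of the [beta i] alone, and freeness of [beta] applies. *)
Lemma fock_map_inj : injective fock_map.
Proof.
apply: raddf_inj => w.
have: exists d, forall x : {mset nat}%mset * I, x \in msupp w -> (mwt x.1 <= d)%N.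
  exists (\max_(x <- msupp w) mwt (x : {mset nat}%mset * I).1)%N => x xw.
  by rewrite (big_rem x xw) leq_maxl.
move=> [d]; elim/ltn_ind: d w => d IH w wd fw0.
have supp0 (x : {mset nat}%mset * I) : x \in msupp w -> x.1 = mset0.
  move=> xw; apply: contraPeq (xw) => x0; apply/negP; rewrite -mcoeff_eq0.
  have [j jx] : exists j, j \in x.1.
    apply: contrapT => /forallNP nj; move/eqP: x0; apply; apply/msetP => j.
    by rewrite mset0E; apply/mset_eq0P/negP.
  have ex : x = ((j +` (x.1 `\ j))%mset, x.2) by rewrite msetB1K //; case: (x).
  have := diff_coeff j (x.1 `\ j)%mset x.2 w; rewrite -ex.
  suff -> : diff j w = 0.
    by rewrite mcoeff0 => /esym/eqP; rewrite mulf_eq0 pnatr_eq0.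
  have dj (y : {mset nat}%mset * I) : y \in msupp (diff j w) -> (mwt y.1 + j < d)%N.
    rewrite -mcoeff_neq0 (_ : y = (y.1, y.2)); last by case: (y).
    rewrite diff_coeff mulf_eq0 negb_or pnatr_eq0 /= mcoeff_neq0 => /wd /=.
    by rewrite mwtD1; lia.
  have d_gt0 : (0 < d)%N.
    by have := wd _ xw; rewrite -(msetB1K jx) mwtD1; lia.
  apply: (IH d.-1) => [|x' /dj|]; [lia|lia|].
  have := fock_diff j w; rewrite fw0 raddf0 => /esym/eqP.
  by rewrite scaler_eq0 mulf_eq0 pnatr_eq0 (negPf N_neq0) => /eqP.
have Xuniq : uniq [seq x.2 | x : {mset nat}%mset * I <- msupp w].
  rewrite map_inj_in_uniq ?fset_uniq // => -[m i] [m' i'] /supp0 /= -> /supp0 /= ->.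
  by move=> ->.
have sum0 : \sum_(i <- [seq x.2 | x : {mset nat}%mset * I <- msupp w])
    mcoeff (mset0, i) w *: beta i = 0.
  rewrite big_map -[RHS]fw0 /= /malg_ext big_seq [RHS]big_seq.
  by apply: eq_bigr => -[m i] /supp0 /= ->; rewrite enum_mset0.
apply/malgP => x; rewrite mcoeff0; apply/eqP; rewrite mcoeff_eq0; apply/negP => xw.
have := beta_free Xuniq sum0 (map_f _ xw); rewrite (_ : (mset0, x.2) = x).
  by apply/eqP; rewrite mcoeff_neq0.
by have := supp0 _ xw; case: (x) => m i /= ->.
Qed.

Lemma range_subspace : is_subspace (range fock_map).
Proof.
split=> [|a _ _ [u _ <-] [v _ <-]]; first by exists 0; rewrite ?raddf0.
by exists (a *: u + v); rewrite // linearP.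
Qed.

Section GradedMonomials.
Variable Vg : int -> set V.
Hypothesis Vg_subspace : forall n, is_subspace (Vg n).
Hypothesis Vg_h : forall n m v, Vg n v -> Vg (n - m) (h m v).
Hypothesis Vg_neg : forall n v, n < 0 -> Vg n v -> v = 0.

Lemma fock_map_onto : (forall n v, Vg n v -> hvac v -> range fock_map v) ->
  forall n v, Vg n v -> range fock_map v.
Proof.
move=> vacW; apply: (hvac_ind Vg_subspace Vg_h Vg_neg (W := fun=> range fock_map)) => //.
  by move=> _; exact: range_subspace.
move=> _ j _ _ [w _ <-]; rewrite [w]malgE (linear_sum fock_map) (linear_sum (h _)).
apply: subspace_sum => [|x _]; first exact: range_subspace.
rewrite (linearZ_LR fock_map) (linearZ_LR (h _)); apply: subspaceZ; first exact: range_subspace.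
suff E (m : {mset nat}%mset) i :
    range fock_map (h (- j.+1%:Z) (fock_map (mkmalgU (m, i) 1))) by case: x => m i; exact: E.
exists (mkmalgU ((j +` m)%mset, i) 1) => //.
apply: etrans (fock_mapU _ _) _; rewrite [X in _ = h _ X](fock_mapU m i).
by rewrite -[RHS]/(creation (j :: m) (beta i)); apply: perm_creation; apply: perm_msetD1.
Qed.

Variables (lv : I -> nat) (B : nat -> seq I).
Hypothesis B_uniq : forall n, uniq (B n).
Hypothesis mem_B : forall n i, (i \in B n) = (lv i == n).
Hypothesis beta_lv : forall i, Vg (lv i) (beta i).
Hypothesis beta_gen : forall (n : nat) v, Vg n v -> hvac v ->
  exists a : I -> K, v = \sum_(i <- B n) a i *: beta i.

(** Monomials span by [hvac_ind] and are independent by [fock_map_inj]. The dimension is the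
    coefficient of q^n in the partition series times the generating series of the levels. *)
Lemma fock_has_dim (n : nat) :
  has_dim (Vg n) (\sum_(j < n.+1) size (parts (n - j)) * size (B j))%N.
Proof.
rewrite -(size_fock_idx mem_B).
pose mon (x : {mset nat}%mset * I) := creation (enum_mset x.1) (beta x.2).
apply: (@has_dim_seq _ _ _ _ mon) => [|x|v Vv|a].
- exact: fock_idx_uniq.
- rewrite mem_fock_idx // => /eqP <-; rewrite addnC PoszD.
  exact: (Vg_creation Vg_h _ (beta_lv x.2)).
- pose W (m : int) := lin_span [set u | exists x : {mset nat}%mset * I,
    (mwt x.1 + lv x.2)%N%:Z = m /\ u = mon x].
  have W_sub m : is_subspace (W m).
    split=> [S [S0 _] //|b u1 u2 Wu1 Wu2 S S_sub S_gen].
    by case: (S_sub) => _; apply; [exact: Wu1|exact: Wu2].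
  have Wv : W n v.
    apply: (hvac_ind Vg_subspace Vg_h Vg_neg) Vv => //.
    + move=> [m|m] u Vu u_vac; last first.
        by rewrite (Vg_neg _ Vu) //; case: (W_sub (Negz m)) => W0 _; exact: W0.
      have [b ->] := beta_gen Vu u_vac; rewrite big_seq; apply: subspace_sum => // i.
      rewrite mem_B // => /eqP im.
      apply: (@subspaceZ _ _ (W m) (b i) (beta i) (W_sub m)) => S S_sub; apply.
      by exists (mset0, i); rewrite /mon /= mwt0 enum_mset0 im.
    move=> m j u _ Wu S S_sub S_gen.
    (* The span is an intersection of subspaces, so the span hypothesis on [u] is applied to the
       preimage of [S] under the creation operator. *)
    apply: (Wu [set u' | S (h (- j.+1%:Z) u')]).
      split=> [|b u1 u2 Su1 Su2 /=]; first by rewrite /= raddf0; case: S_sub.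
      by rewrite linearP; case: S_sub => _; apply.
    move=> _ [[mu i] [mE ->]] /=; apply: S_gen; exists ((j +` mu)%mset, i); split.
      by move: mE; rewrite /= mwtD1; lia.
    rewrite -[LHS]/(creation (j :: mu) (beta i)) /mon.
    by apply/esym/perm_creation; apply: perm_msetD1.
  apply: (Wv [set u | exists a : _ -> K, u = \sum_(x <- fock_idx lv B n) a x *: mon x]).
    split=> [|b _ _ [a1 ->] [a2 ->]].
      by exists (fun=> 0); rewrite big1 // => x _; rewrite scale0r.
    exists (fun x => b * a1 x + a2 x); rewrite scaler_sumr -big_split /=.
    by apply: eq_bigr => x _; rewrite scalerDl scalerA.
  move=> _ [x [/eqP xn ->]] /=; exists (fun y => (y == x)%:R).
  rewrite (bigD1_seq x) ?fock_idx_uniq //=; last by rewrite mem_fock_idx.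
  rewrite eqxx scale1r big1 ?addr0 // => y /negPf ->.
  by rewrite scale0r.
move=> a0 x xX.
have w0 : \sum_(y <- fock_idx lv B n) a y *: (mkmalgU y 1 : fock) = 0.
  apply: fock_map_inj; rewrite raddf0 -[RHS]a0 (linear_sum fock_map).
  by apply: eq_bigr => -[m i] _; rewrite (linearZ_LR fock_map) fock_mapU.
have := mcoeff_sumU a x (fock_idx_uniq B_uniq mem_B n).
by rewrite xX w0 mcoeff0.
Qed.

End GradedMonomials.
End Monomials.
End HeisenbergModule.

(** * Vertex algebra calculus *)

Section GeneralizedBinomial.
Variable K : numFieldType.

Lemma gbin0 m : gbin K m 0 = 1.
Proof. by rewrite /gbin big_ord0 fact0 divr1. Qed.

Lemma gbin1 m : gbin K m 1 = m%:~R.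
Proof. by rewrite /gbin big_ord_recl big_ord0 subr0 mulr1 divr1. Qed.

Lemma gbin_small (n i : nat) : (n < i)%N -> gbin K n i = 0.
Proof. by move=> ni; rewrite /gbin (bigD1 (Ordinal ni)) //= subrr !mul0r. Qed.

Lemma gbin_opp (j i : nat) : (-1) ^+ i * gbin K (- j.+1%:Z) i = 'C(j + i, i)%:R.
Proof.
have f0 : (i`!%:R : K) != 0 by rewrite pnatr_eq0 -lt0n fact_gt0.
have g0 : (j`!%:R : K) != 0 by rewrite pnatr_eq0 -lt0n fact_gt0.
apply: (mulIf f0); apply: (mulIf g0); rewrite -!natrM -mulnA.
have -> : ('C(j + i, i) * (i`! * j`!) = (j + i)`!)%N.
  by have := bin_fact (leq_addl j i); rewrite addnK.
rewrite /gbin mulrA divfK //.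
elim: i f0 => [|i IH] f0; first by rewrite big_ord0 expr0 !mul1r addn0.
rewrite big_ord_recr exprS /= addnS factS natrM -IH; last first.
  by rewrite pnatr_eq0 -lt0n fact_gt0.
by rewrite mulrNz -[in RHS]addSn natrD -pmulrn; ring.
Qed.

Lemma gbinN1 i : gbin K (-1) i = (-1) ^+ i.
Proof.
have := gbin_opp 0 i; rewrite add0n binn => /(congr1 (fun x => (-1) ^+ i * x)).
by rewrite mulrA -expr2 sqrr_sign mul1r mulr1.
Qed.

End GeneralizedBinomial.

Section VertexAlgebra.
Variables (K : numFieldType) (V : voaData K).
Hypothesis V_voa : is_voa V.
Implicit Types (u v w : V) (l m n : int).
Local Notation Vw := (@Vwt K V).

Fact vnth_linear_r u n : linear (vnth u n).
Proof. by case: V_voa => -[[_ H] _ _ _] *; apply: H. Qed.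

Fact vnth_linear_l n w : linear (fun u : V => vnth u n w).
Proof. by case: V_voa => -[[H _] _ _ _] *; apply: H. Qed.

Definition mode u n : {linear V -> V} :=
  HB.pack (vnth u n) (GRing.isLinear.Build K V V _ (vnth u n) (vnth_linear_r u n)).

Definition lmode n w : {linear V -> V} := HB.pack (fun u : V => vnth u n w)
  (GRing.isLinear.Build K V V _ (fun u : V => vnth u n w) (vnth_linear_l n w)).

Lemma vnth0r u n : vnth u n 0 = 0. Proof. exact: (raddf0 (mode u n)). Qed.
Lemma vnth0l n w : vnth 0 n w = 0. Proof. exact: (raddf0 (lmode n w)). Qed.
Lemma vnthZr u n a w : vnth u n (a *: w) = a *: vnth u n w.
Proof. exact: (linearZ_LR (mode u n)). Qed.
Lemma vnthZl u n a w : vnth (a *: u) n w = a *: vnth u n w.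
Proof. exact: (linearZ_LR (lmode n w)). Qed.
Lemma vnthDr u n v w : vnth u n (v + w) = vnth u n v + vnth u n w.
Proof. exact: (raddfD (mode u n)). Qed.
Lemma vnthBr u n v w : vnth u n (v - w) = vnth u n v - vnth u n w.
Proof. exact: (raddfB (mode u n)). Qed.
Lemma vnthDl u v n w : vnth (u + v) n w = vnth u n w + vnth v n w.
Proof. exact: (raddfD (lmode n w)). Qed.
Lemma vnthBl u v n w : vnth (u - v) n w = vnth u n w - vnth v n w.
Proof. exact: (raddfB (lmode n w)). Qed.

Lemma vnth_trunc u w : exists N : int, forall n, N <= n -> vnth u n w = 0.
Proof. by case: V_voa => -[_ H _ _] *; apply: H. Qed.

Lemma vnth_vac n w : vnth (vac V) n w = if n == -1 then w else 0.
Proof. by case: V_voa => -[_ _ H _] *; apply: H. Qed.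

Lemma vnthN1_vac u : vnth u (-1) (vac V) = u.
Proof. by case: V_voa => _ /(_ u)[]. Qed.

Lemma vnth_ge0_vac u n : 0 <= n -> vnth u n (vac V) = 0.
Proof. by case: n => // n _; case: V_voa => _ /(_ u)[]. Qed.

Lemma borcherds u v w l m n :
  \sum_(i \in [set: nat]) gbin K m i *: vnth (vnth u (l + i%:Z) v) (m + n - i%:Z) w
  = \sum_(i \in [set: nat]) ((-1) ^+ i * gbin K l i) *:
      (vnth u (m + l - i%:Z) (vnth v (n + i%:Z) w)
       - (-1) ^ l *: vnth v (n + l - i%:Z) (vnth u (m + i%:Z) w)).
Proof. by case: V_voa => -[_ _ _ H] *; apply: H. Qed.

(** The Borcherds identity at l = 0, where only i = 0 survives on the right. *)
Lemma vnth_comm u v w m n : vnth u m (vnth v n w) - vnth v n (vnth u m w) =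
  \sum_(i \in [set: nat]) gbin K m i *: vnth (vnth u i%:Z v) (m + n - i%:Z) w.
Proof.
have := borcherds u v w 0 m n; under eq_fsbigr do rewrite add0r; move=> ->.
rewrite (@fsbig_nat_ord _ _ 1) => [|i i0]; last by rewrite gbin_small ?mulr0 ?scale0r.
by rewrite big_ord_recl big_ord0 /= expr0 expr0z gbin0 mulr1 !scale1r ?addr0 ?subr0 ?addr0.
Qed.

Lemma vnth_assoc u v w l n : vnth (vnth u l v) n w =
  \sum_(i \in [set: nat]) ((-1) ^+ i * gbin K l i) *:
    (vnth u (l - i%:Z) (vnth v (n + i%:Z) w) - (-1) ^ l *: vnth v (n + l - i%:Z) (vnth u i%:Z w)).
Proof.
have := borcherds u v w l 0 n; under [X in _ = X]eq_fsbigr do rewrite !add0r; move=> <-.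
rewrite (@fsbig_nat_ord _ _ 1) => [|i i0]; last by rewrite gbin_small ?scale0r.
by rewrite big_ord_recl big_ord0 /= gbin0 scale1r ?addr0 ?subr0 ?addr0 ?add0r.
Qed.

(** The case l = -(j+1) of [vnth_assoc], written in the exact shape of the recursion that defines
    [lat_vop]. *)
Lemma vnth_normal_order u v w (j : nat) n : vnth (vnth u (- j.+1%:Z) v) n w =
  \sum_(i \in [set: nat]) 'C(j + i, i)%:R *:
    (vnth u (- (j + i).+1%N%:Z) (vnth v (n + i%:Z) w) +
     (-1) ^+ j *: vnth v (n - (j + i).+1%N%:Z) (vnth u i%:Z w)).
Proof.
rewrite vnth_assoc; apply: eq_fsbigr => i _; rewrite gbin_opp.
congr (_ *: (_ + _)); first by congr (vnth _ _ _); lia.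
rewrite -scaleNr; congr (_ *: vnth _ _ _); last lia.
by rewrite -invr_expz -exprnP exprS mulN1r invrN invr_sign opprK.
Qed.

(** The Borcherds identity on the vacuum with m = -1 and n = 0: on the right only [v_l u_(-1) 1]
    survives. *)
Lemma vnth_skew u v l : vnth v l u =
  - (-1) ^ l *: \sum_(i \in [set: nat]) (-1) ^+ i *: vnth (vnth u (l + i%:Z) v) (-1 - i%:Z) (vac V).
Proof.
have := borcherds u v (vac V) l (-1) 0.
under eq_fsbigr do rewrite gbinN1 addr0; move=> ->.
rewrite (@fsbig_nat_ord _ _ 1) => [|i i0]; last first.
  rewrite (vnth_ge0_vac v) // (vnth_ge0_vac u); last lia.
  by rewrite !vnth0r scaler0 subr0 scaler0.
rewrite big_ord_recl big_ord0 /= gbin0 mulr1 expr0 scale1r ?addr0 ?add0r ?subr0 vnthN1_vac.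
rewrite vnth_ge0_vac // vnth0r sub0r scalerN scaleNr opprK scalerA.
by rewrite -expfzMl mulrNN mulr1 exp1rz scale1r.
Qed.

Lemma LN1E v : Lvir (-1) v = vnth (conf V) 0 v. Proof. by []. Qed.
Lemma L1E v : Lvir 1 v = vnth (conf V) 2 v. Proof. by []. Qed.

Lemma VwtE n v : Vw n v <-> vnth (conf V) 1 v = n%:~R *: v. Proof. by []. Qed.

Lemma Vwt_subspace n : is_subspace (Vw n).
Proof. by case: V_voa => _ _ _ _ [[H _ _] _ _]; exact: H. Qed.

Lemma Vwt_sum v : sum_of (Vw) v.
Proof. by case: V_voa => _ _ _ _ [[_ H _] _ _]. Qed.

Lemma Vwt_ind (W : set V) : is_subspace W -> (forall n, Vw n `<=` W) -> forall v, W v.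
Proof.
move=> W_sub VW v; have [s [f [Vf ->]]] := Vwt_sum v.
by apply: subspace_sum => // i _; apply: (VW i).
Qed.

Lemma Vwt_fin_dim n : fin_dim (Vw n).
Proof. by case: V_voa => _ _ _ _ []. Qed.

Lemma Vwt_disjoint m n v : Vw m v -> Vw n v -> m != n -> v = 0.
Proof.
move=> /VwtE mv /VwtE; rewrite mv => /eqP; rewrite -subr_eq0 -scalerBl scaler_eq0.
by rewrite -mulrzBr intr_eq0 subr_eq0 => /orP[/eqP ->|/eqP //]; rewrite eqxx.
Qed.

Lemma vnth_derivative u n v : vnth (Lvir (-1) u) n v = - n%:~R *: vnth u (n - 1) v.
Proof. by case: V_voa. Qed.

Lemma virasoro m n v : Lvir m (Lvir n v) - Lvir n (Lvir m v)
  = (m - n)%:~R *: Lvir (m + n) v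
    + (if m + n == 0 then (m ^+ 3 - m)%:~R / 12%:R * ccharge V else 0) *: v.
Proof. by case: V_voa. Qed.

Lemma conf1_comm u n w : vnth (conf V) 1 (vnth u n w) - vnth u n (vnth (conf V) 1 w) =
  vnth (vnth (conf V) 1 u) n w - (n + 1)%:~R *: vnth u n w.
Proof.
rewrite vnth_comm (@fsbig_nat_ord _ _ 2) => [|i i2]; last by rewrite gbin_small // scale0r.
rewrite !big_ord_recl big_ord0 /= gbin0 gbin1 !scale1r ?addr0 ?subr0 addrC.
congr (vnth _ _ _ + _); first by rewrite /bump /=; lia.
rewrite -LN1E vnth_derivative scaleNr; congr (- (_%:~R *: vnth _ _ _)); lia.
Qed.

Lemma Vwt_vnth k m u w n : Vw k u -> Vw m w -> Vw (k + m - n - 1) (vnth u n w).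
Proof.
move=> /VwtE ku /VwtE mw; apply/VwtE; move/eqP: (conf1_comm u n w).
rewrite subr_eq ku mw vnthZl vnthZr => /eqP ->.
by rewrite -scalerBl -scalerDl; congr (_ *: _); rewrite -!(rmorphB, rmorphD) /=; congr (_%:~R); lia.
Qed.

(** [L(0), L(-2)] = 2 L(-2) applied to the vacuum, as L(-2) sends the vacuum to the conformal
    vector. *)
Lemma conf_wt : Vw 2 (conf V).
Proof.
have := virasoro 0 (-2) (vac V); rewrite /Lvir /Lop /= add0r  => /eqP.
rewrite [vnth _ _ (vac V) in X in _ - X]vnth_ge0_vac // vnth0r subr0 add0r.
by rewrite scale0r addr0 -[(-2 + 1)]/(-1 : int) vnthN1_vac => /eqP.
Qed.

Lemma LN1_wt n v : Vw n v -> Vw (n + 1) (Lvir (-1) v).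
Proof. by move=> nv; have := Vwt_vnth 0 conf_wt nv; congr (Vw _ _); lia. Qed.

Lemma vac_wt : Vw 0 (vac V).
Proof. by apply/VwtE; rewrite vnth_ge0_vac // scale0r. Qed.

Lemma LN1_eq0 u n w : Lvir (-1) u = 0 -> n != -1 -> vnth u n w = 0.
Proof.
move=> Lu0 n1; have := vnth_derivative u (n + 1) w; rewrite Lu0 vnth0l addrK => /esym/eqP.
by rewrite scaler_eq0 oppr_eq0 intr_eq0 addr_eq0 (negPf n1) => /eqP.
Qed.

Lemma L1_conf : vnth (conf V) 2 (conf V) = 0.
Proof.
have := virasoro 1 (-2) (vac V); rewrite /Lvir /Lop /= => /eqP.
rewrite [vnth _ _ (vac V) in X in _ - X]vnth_ge0_vac // vnth0r subr0.
by rewrite -[(-2 + 1)]/(-1 : int) vnthN1_vac vnth_ge0_vac // scale0r scaler0 addr0 => /eqP.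
Qed.

Section CFT.
Hypothesis V_cft : CFT_type V.

Lemma Vwt_neg n v : n < 0 -> Vw n v -> v = 0.
Proof. by case: V_cft => H _ n0; rewrite (H n n0). Qed.

Lemma Vwt0_vac v : Vw 0 v -> exists a, v = a *: vac V.
Proof. by case: V_cft => _ ->. Qed.

(** * The invariant bilinear form given by self-contragredience *)

Section InvariantForm.
Hypothesis V_self : self_contragredient V.

(** If L(1) u = 0, only the term i = 0 of [contragredient_act] remains. For the conformal vector
    this makes L(0) self-adjoint, so distinct weights are orthogonal and injectivity of V -> V'
    becomes nondegeneracy on each weight space. *)
Lemma invariant_form : exists phi : V -> V -> K,
  [/\ forall w, linear (phi^~ w : V -> K^o), forall v, linear (phi v : V -> K^o),
      forall k n u v w, Vw k u -> Lvir 1 u = 0 ->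
        phi (vnth u n v) w = (-1) ^ k * phi v (vnth u (2 * k - n - 2) w)
    & forall m v, Vw m v -> v != 0 -> exists2 w, Vw m w & phi v w != 0].
Proof.
case: V_self => phi [phi_lin phi_inj phi_range phi_act].
have phi0 w : phi 0 w = 0.
  by have := phi_lin w (-1) 0 0; rewrite scaler0 addr0 scaleN1r addNr.
have phiZ a v w : phi (a *: v) w = a * phi v w.
  by have := phi_lin w a v 0; rewrite !addr0 phi0 addr0.
have phi_r v : linear (phi v : V -> K^o).
  by have : range phi (phi v) by []; rewrite phi_range => -[].
have phir0 v : phi v 0 = 0.
  by have := phi_r v (-1) 0 0; rewrite scaler0 addr0 scaleN1r addNr.
have phirZ v a w : phi v (a *: w) = a * phi v w.
  by have := phi_r v a w 0; rewrite !addr0 phir0 addr0.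
have act1 k' n x v w : Vw k' x -> Lvir 1 x = 0 ->
    phi (vnth x n v) w = (-1) ^ k' * phi v (vnth x (2 * k' - n - 2) w).
  move=> kx Lx0; rewrite (phi_act _ _ _ _ _ kx) /contragredient_act.
  rewrite (@fsbig_nat_ord K _ 1) => [|[//|i] _]; last first.
    by rewrite iterSr Lx0 (_ : iter i (Lvir 1) 0 = 0) ?vnth0l ?phir0 ?mulr0 //;
      elim: i => //= i ->; rewrite L1E vnth0r.
  by rewrite big_ord_recl big_ord0 /= fact0 divr1 addr0 subr0.
have L0adj v w : phi (vnth (conf V) 1 v) w = phi v (vnth (conf V) 1 w).
  by rewrite (act1 2 1 _ v w conf_wt L1_conf) -exprnP sqrrN expr1n mul1r.
have phi_wt m n v w : Vw m v -> Vw n w -> m != n -> phi v w = 0.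
  move=> /VwtE mv /VwtE nw mn; have := L0adj v w; rewrite mv nw phiZ phirZ => /eqP.
  by rewrite -subr_eq0 -mulrBl mulf_eq0 -rmorphB intr_eq0 subr_eq0 (negPf mn) => /eqP.
have phi_nz m v : Vw m v -> v != 0 -> exists2 w, Vw m w & phi v w != 0.
  move=> mv v0; apply: contrapT => nw; case/eqP: v0; apply: phi_inj.
  apply/funext => w; rewrite phi0; move: w; apply: Vwt_ind.
    by split=> [|a x y /= x0 y0]; rewrite ?phir0 // phi_r x0 y0 scaler0 addr0.
  move=> n w nw' /=; have [e|ne] := eqVneq m n; last exact: phi_wt ne.
  by apply: contrapT => /eqP p0; apply: nw; exists w; rewrite ?e.
by exists phi; split.
Qed.

(** L(1) v is a multiple of the vacuum. Its pairing with the vacuum equals the pairing of L(-1) 1 =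
    0 with v, while nondegeneracy on V_0 makes the vacuum pair nontrivially with itself. *)
Lemma L1_wt1 v : Vw 1 v -> Lvir 1 v = 0.
Proof.
move=> v1; have [phi [phi_l phi_r phi_act phi_nz]] := invariant_form.
have [a aE] : exists a, Lvir 1 v = a *: vac V.
  by apply: Vwt0_vac; have := Vwt_vnth 2 conf_wt v1.
have [vac0|vac0] := eqVneq (vac V) 0; first by rewrite aE vac0 scaler0.
have [w /Vwt0_vac[b ->] pw] := phi_nz _ _ vac_wt vac0.
have phir0 u : phi u 0 = 0.
  by have := phi_r u (-1) 0 0; rewrite scaler0 addr0 scaleN1r addNr.
have phirZ u c x : phi u (c *: x) = c * phi u x.
  by have := phi_r u c x 0; rewrite !addr0 phir0 addr0.
have := phi_act _ 0 _ (vac V) v conf_wt L1_conf.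
rewrite vnth_ge0_vac // (_ : vnth (conf V) _ v = Lvir 1 v) // aE phirZ -exprnP sqrrN expr1n mul1r.
have -> : phi 0 v = 0.
  by have := phi_l v (-1) 0 0; rewrite scaler0 addr0 scaleN1r addNr.
move=> /esym/eqP; rewrite mulf_eq0 => /orP[/eqP ->|/eqP p0]; first by rewrite scale0r.
by move: pw; rewrite phirZ p0 mulr0 eqxx.
Qed.

(** Writing u as [u_(-1) 1] and moving it across the form turns the pairing of u with w into that of
    1 with [u_(2k-1) w], which lies in V_0. *)
Lemma quasi_primary_pairing (k : int) u : Vw k u -> Lvir 1 u = 0 -> u != 0 ->
  vac V != 0 /\ exists2 w, Vw k w & vnth u (2 * k - 1) w = vac V.
Proof.
move=> ku Lu0 u0; have [phi [_ phi_r act1 phi_nz]] := invariant_form.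
have phir0 v : phi v 0 = 0.
  by have := phi_r v (-1) 0 0; rewrite scaler0 addr0 scaleN1r addNr.
have [w kw pw0] := phi_nz _ _ ku u0.
have pE : phi u w = (-1) ^ k * phi (vac V) (vnth u (2 * k - 1) w).
  rewrite -[X in phi X w]vnthN1_vac (act1 k) //.
  by congr (_ * phi _ (vnth _ _ _)); lia.
have [a aE] : exists a, vnth u (2 * k - 1) w = a *: vac V.
  by apply: Vwt0_vac; have := Vwt_vnth (2 * k - 1) ku kw; congr (Vw _ _); lia.
have a0 : a != 0.
  by apply: contraNneq pw0 => a0; rewrite pE aE a0 scale0r phir0 mulr0.
split; first by apply: contraNneq pw0 => v0; rewrite pE aE v0 scaler0 phir0 mulr0.
exists (a^-1 *: w); last by rewrite vnthZr aE scalerA mulVf ?scale1r.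
by apply: subspaceZ => //; exact: Vwt_subspace.
Qed.

End InvariantForm.

(** * The Heisenberg field of h and its Sugawara vector *)

Section HeisenbergField.
Variables (h : V) (N : K).
Hypothesis h_wt : Vw 1 h.
Hypothesis h_norm : vnth h 1 h = N *: vac V.
Hypothesis h_prim : Lvir 1 h = 0.
Hypothesis N_neq0 : N != 0.

Local Notation H := (mode h).

(** Skew symmetry gives [h_0 h = - h_0 h]: the next term is a mode of [h_1 h], a multiple of the
    vacuum, with index -2, hence 0. *)
Lemma h0_h : vnth h 0 h = 0.
Proof.
have := vnth_skew h h 0; rewrite (@fsbig_nat_ord _ _ 2) => [|[|[|i]] //= _]; last first.
  have Vneg := Vwt_vnth i.+2%:Z h_wt h_wt.
  by rewrite add0r (Vwt_neg _ Vneg) ?vnth0l ?scaler0 //; lia.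
rewrite !big_ord_recl big_ord0 /= add0r h_norm vnthZl vnth_vac /= !scaler0 !addr0 expr0z.
rewrite expr0 scale1r ?addr0 ?subr0 vnthN1_vac scaleN1r => /eqP.
by rewrite -addr_eq0 -mulr2n -scaler_nat scaler_eq0 pnatr_eq0 => /eqP.
Qed.

Lemma heis_comm m n v : H m (H n v) - H n (H m v) =
  (if m + n == 0 then m%:~R * N else 0) *: v.
Proof.
rewrite /= vnth_comm (@fsbig_nat_ord _ _ 2) => [|[|[|i]] //= _]; last first.
  by rewrite (Vwt_neg _ (Vwt_vnth i.+2%:Z h_wt h_wt)) ?vnth0l ?scaler0 //; lia.
rewrite !big_ord_recl big_ord0 /= h0_h h_norm vnth0l scaler0 add0r addr0 gbin1.
rewrite vnthZl vnth_vac scalerA (_ : (_ == -1) = (m + n == 0)); last first.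
  by rewrite /bump /=; apply/eqP/eqP; lia.
by case: eqP; rewrite ?scaler0 ?scale0r.
Qed.

Lemma heis_primary_comm c u m n w : hvac H u -> H 0 u = c *: u ->
  H m (vnth u n w) - vnth u n (H m w) = c *: vnth u (m + n) w.
Proof.
move=> u_vac cu; rewrite /= vnth_comm (@fsbig_nat_ord _ _ 1) => [|[|i] //= _]; last first.
  by rewrite [vnth h i.+1 u](u_vac i) vnth0l scaler0.
by rewrite big_ord_recl big_ord0 /= [vnth h 0 u]cu gbin0 scale1r vnthZl ?addr0 ?subr0.
Qed.

Lemma conf_heis_comm m n w :
  vnth (conf V) m (H n w) - H n (vnth (conf V) m w) = - n%:~R *: H (m + n - 1) w.
Proof.
rewrite /= vnth_comm (@fsbig_nat_ord _ _ 2) => [|[|[|[|i]]] //= _]; last 2 first.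
- by rewrite [vnth _ 2 h]h_prim vnth0l scaler0.
- by rewrite (Vwt_neg _ (Vwt_vnth i.+3%:Z conf_wt h_wt)) ?vnth0l ?scaler0 //; lia.
rewrite !big_ord_recl big_ord0 /= gbin0 gbin1 scale1r addr0.
rewrite -LN1E vnth_derivative ?subr0 (iffLR (VwtE 1 h) h_wt) scale1r.
rewrite /bump addn0 addr0 -scalerDl; congr (_ *: _); rewrite rmorphD /=; ring.
Qed.

Lemma heis_conf (n : nat) : H n (conf V) = if n == 1%N then h else 0.
Proof.
have /eqP := conf_heis_comm (-1) n (vac V).
rewrite /= vnth_ge0_vac // vnth0r sub0r vnthN1_vac scaleNr eqr_opp => /eqP ->.
case: n => [|[|n]] /=; first by rewrite scale0r.
  by rewrite scale1r vnthN1_vac.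
by rewrite vnth_ge0_vac ?scaler0 //; lia.
Qed.

Lemma heis_hh (n : nat) : H n (vnth h (-1) h) = if n == 1%N then (2 * N) *: h else 0.
Proof.
have /eqP := heis_comm n (-1) h; rewrite subr_eq => /eqP /= ->.
case: n => [|[|n]] /=; first by rewrite h0_h vnth0r scale0r addr0.
  by rewrite h_norm vnthZr vnthN1_vac mul1r -scalerDl; congr (_ *: _); ring.
rewrite scale0r add0r (Vwt_neg _ (Vwt_vnth n.+2%:Z h_wt h_wt)) ?vnth0r //; lia.
Qed.

Lemma heis_wt n m v : Vw n v -> Vw (n - m) (H m v).
Proof. by move=> nv; have := Vwt_vnth m h_wt nv; congr (Vw _ _); lia. Qed.

Definition sugawara : V := (2 * N)^-1 *: vnth h (-1) h.

Lemma conf_sub_sugawara : [/\ Vw 2 (conf V - sugawara), hvac H (conf V - sugawara) &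
  H 0 (conf V - sugawara) = 0].
Proof.
have HH (n : nat) : H n (conf V - sugawara) = 0.
  rewrite raddfB /= [vnth h n (conf V)]heis_conf vnthZr [vnth h n _]heis_hh.
  case: eqP => _; last by rewrite scaler0 subrr.
  by rewrite scalerA mulVf ?scale1r ?subrr // mulf_neq0 ?pnatr_eq0.
split=> [|j|]; [|exact: HH|exact: HH].
apply: subspaceB; [exact: Vwt_subspace|exact: conf_wt|].
by apply: subspaceZ; [exact: Vwt_subspace|exact: (Vwt_vnth (-1) h_wt h_wt)].
Qed.

Lemma sugawara_mode n w : vnth sugawara n w = (2 * N)^-1 *: \sum_(i \in [set: nat])
  (H (-1 - i%:Z) (H (n + i%:Z) w) + H (n - 1 - i%:Z) (H i%:Z w)).
Proof.
rewrite vnthZl vnth_assoc; congr (_ *: _); apply: eq_fsbigr => i _ /=.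
rewrite gbinN1 -expr2 sqrr_sign scale1r; congr (_ + _).
by rewrite -scaleNr -[(-1) ^ _]/((-1)^-1) invrN1 opprK scale1r.
Qed.

Lemma sugawara1 u : hvac H u -> vnth sugawara 1 u = (2 * N)^-1 *: H 0 (H 0 u).
Proof.
move=> u_vac; rewrite sugawara_mode (@fsbig_nat_ord _ _ 1) => [|[|i] //= _]; last first.
  by rewrite [vnth h i.+1 u](u_vac i) [vnth h _ u](u_vac i.+1) !vnth0r addr0.
rewrite big_ord_recl big_ord0 [H (1 + _) u](u_vac 0) raddf0 add0r addr0 subrr.
by [].
Qed.

Lemma sugawara0 c u : hvac H u -> H 0 u = c *: u ->
  vnth sugawara 0 u = (c / N) *: H (-1) u.
Proof.
move=> u_vac cu; rewrite sugawara_mode (@fsbig_nat_ord _ _ 1) => [|[|i] //= _]; last first.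
  by rewrite add0r [vnth h i.+1 u](u_vac i) !vnth0r addr0.
rewrite big_ord_recl big_ord0 /= ?addr0 ?subr0 ?add0r [vnth h 0 u]cu vnthZr.
rewrite -scalerDl scalerA; congr (_ *: _); field.
exact: N_neq0.
Qed.

(* conf - sugawara generates a commuting Virasoro algebra of central charge 0; its image under
   L(-1) is again an h-vacuum, of weight 3. *)
Lemma conf_sugawara : (forall v, Vw 2 v -> hvac H v -> v = 0) \/
  (forall v, Vw 3 v -> hvac H v -> v = 0) -> conf V = sugawara.
Proof.
have [w2 wvac w0] := conf_sub_sugawara; move: w2 wvac w0.
set w := conf V - sugawara => w2 wvac w0 VH.
suff: w = 0 by move/eqP; rewrite subr_eq0 => /eqP.
case: VH => [H2|H3]; first exact: H2.
have Lw0 : Lvir (-1) w = 0.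
  apply: H3 => [|j]; first exact: (LN1_wt w2).
  have := conf_heis_comm 0 j.+1 w; rewrite (wvac j) vnth0r sub0r => E.
  apply/eqP; rewrite -oppr_eq0; apply/eqP; rewrite E.
  case: j {E} => [|j]; first by rewrite -[0 + 1 - 1]/(0 : int) w0 scaler0.
  by rewrite (_ : 0 + _ - 1 = j.+1%:Z) ?(wvac j) ?scaler0 //; lia.
(* Since h(0) w = 0, the Sugawara part contributes nothing and [w_1 w] is L(0) w = 2 w; but L(-1) w
   = 0 leaves [w] no mode other than [w_(-1)]. *)
have : vnth w 1 w = 2%:R *: w.
  rewrite {1}/w vnthBl (iffLR (VwtE 2 w) w2) sugawara1 // w0 raddf0 scaler0 subr0.
  by [].
rewrite (LN1_eq0 _ Lw0) // => /esym/eqP.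
by rewrite scaler_eq0 pnatr_eq0 => /eqP.
Qed.

(** * Charge sectors of the vacuum space and their leading products *)

Section LatticeSectors.
Variable k : nat.
Hypothesis k_gt0 : (0 < k)%N.
Hypothesis N_k : N = (2 * k)%N%:R.
Hypothesis conf_sug : conf V = sugawara.

Let hcomm := heis_comm.

Definition sector (a : int) : set V :=
  [set u | hvac H u /\ H 0 u = (2 * k%:Z * a)%:~R *: u].

Lemma sector_wt a u : sector a u -> Vw (k%:Z * a ^+ 2) u.
Proof.
move=> [uv ua]; apply/VwtE; rewrite conf_sug sugawara1 // ua linearZ_LR ua !scalerA.
congr (_ *: _); rewrite N_k natrM !intrM ?expr2 ?intrM -?pmulrn.
by field; rewrite pnatr_eq0 -lt0n.
Qed.

(** Commuting [h (j+1)] past [u_n] produces [u_(n+j+1) v], which vanishes when n is the highest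
    surviving index. *)
Lemma sector_mode a b u v n : sector a u -> sector b v ->
  (forall m, n < m -> vnth u m v = 0) -> sector (a + b) (vnth u n v).
Proof.
move=> [uv ua] [vv vb] top; split=> [j|].
  have /eqP := heis_primary_comm j.+1 n v uv ua; rewrite subr_eq => /eqP ->.
  by rewrite (vv j) vnth0r addr0 top ?scaler0 //; lia.
have /eqP := heis_primary_comm 0 n v uv ua; rewrite subr_eq => /eqP ->.
by rewrite vb vnthZr add0r -scalerDl; congr (_ *: _); rewrite -rmorphD /= mulrDr.
Qed.

(** Downward induction from the truncation bound. A highest surviving [u_m v] lies in sector a + b,
    of weight k (a+b)^2; as a mode it has weight k a^2 + k b^2 - m - 1. The two agree only for m =
    -2kab - 1. *)
Lemma sector_top a b u v n : sector a u -> sector b v ->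
  - (2 * k%:Z * a * b) - 1 < n -> vnth u n v = 0.
Proof.
move=> ua vb; have [M Mtop] := vnth_trunc u v.
suff: forall (d : nat) m, M - d%:Z <= m -> - (2 * k%:Z * a * b) - 1 < m -> vnth u m v = 0.
  by move=> /(_ `|M - n|%N n) H0 n_gt; apply: H0 => //; lia.
elim=> [|d IH] m md m_gt; first by apply: Mtop; lia.
have uv_sector : sector (a + b) (vnth u m v).
  by apply: sector_mode => // m' mm'; apply: IH; lia.
have w1 := Vwt_vnth m (sector_wt ua) (sector_wt vb).
apply: (Vwt_disjoint w1 (sector_wt uv_sector)); apply/eqP.
by rewrite sqrrD; nia.
Qed.

(* The leading coefficient of Y(u, z) v. *)
Definition star (a b : int) u v : V := vnth u (- (2 * k%:Z * a * b) - 1) v.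

Lemma star_sector a b u v : sector a u -> sector b v -> sector (a + b) (star a b u v).
Proof. by move=> ua vb; apply: sector_mode => // m; apply: sector_top. Qed.

(** Only the leading term of skew symmetry remains, and its sign is +1 because -2kab - 1 is odd.
    This is the evenness of the lattice at work. *)
Lemma starC a b u v : sector a u -> sector b v -> star a b u v = star b a v u.
Proof.
move=> ua vb; rewrite /star; set n := (X in vnth u X v).
have -> : - (2 * k%:Z * b * a) - 1 = n by rewrite /n; lia.
rewrite (vnth_skew v u) (@fsbig_nat_ord _ _ 1) => [|i i1]; last first.
  by rewrite (sector_top vb ua) ?vnth0l ?scaler0 //; lia.
rewrite big_ord_recl big_ord0 /= expr0 scale1r ?addr0 ?subr0 vnthN1_vac -[RHS]scale1r.
have -> : n = 2 * (- (k%:Z * a * b)) + (-1) by rewrite /n; lia.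
rewrite expfzDr ?oppr_eq0 ?oner_eq0 // -exprz_exp -exprnP sqrrN expr1n exp1rz mul1r.
by rewrite -[(-1) ^ _]/((-1)^-1) invrN1 opprK.
Qed.

(** In the Borcherds identity, l and n are the leading indices of u on v and of v on w, while m is
    one above the leading index of u on w. So the terms where u acts first on w vanish, and one term
    is left on each side. *)
Lemma starA a b c u v w : sector a u -> sector b v -> sector c w ->
  star (a + b) c (star a b u v) w = star a (b + c) u (star b c v w).
Proof.
move=> ua vb wc; rewrite /star.
have := borcherds u v w (- (2 * k%:Z * a * b) - 1)
  (- (2 * k%:Z * a * c)) (- (2 * k%:Z * b * c) - 1).
rewrite (@fsbig_nat_ord _ _ 1) => [|i i1]; last first.
  by rewrite (sector_top ua vb) ?vnth0l ?scaler0 //; lia.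
rewrite (@fsbig_nat_ord _ _ 1) => [|i i1]; last first.
  rewrite (sector_top vb wc) ?vnth0r ?scaler0; last lia.
  by rewrite (sector_top ua wc) ?vnth0r ?scaler0 ?subr0 ?scaler0 //; lia.
rewrite !big_ord_recl !big_ord0 /= !gbin0 expr0 mulr1 !scale1r ?addr0 ?subr0.
rewrite [vnth u (- (2 * k%:Z * a * c)) w](sector_top ua wc); last lia.
rewrite vnth0r scaler0 subr0 => E.
by move: E; congr (vnth _ _ _ = vnth _ _ _); lia.
Qed.

(** A coefficient of d/dz Y(u, z) v = a :h(z) Y(u, z): v. The contribution of h(0) v = 2kb v, moved
    to the left, changes the factor coming from the derivative into [s]. *)
Lemma star_rec a b u v (s : nat) : sector a u -> sector b v ->
  s%:R *: vnth u (- (2 * k%:Z * a * b) - 1 - s%:Z) v =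
  a%:~R *: \sum_(j < s) H (- j.+1%:Z) (vnth u (- (2 * k%:Z * a * b) - 1 - (s - j.+1)%N%:Z) v).
Proof.
move=> ua vb; have [uv u0] := ua; have [vv v0] := vb.
set p := - (2 * k%:Z * a * b).
have Lu : Lvir (-1) u = a%:~R *: H (-1) u.
  rewrite LN1E conf_sug (sugawara0 uv u0) N_k; congr (_ *: _).
  rewrite natrM !intrM -pmulrn; field.
  by rewrite pnatr_eq0 -lt0n.
have := vnth_derivative u (p - s%:Z) v; rewrite Lu vnthZl.
rewrite (vnth_normal_order h u v 0) (@fsbig_nat_ord _ _ s.+1) => [|i si]; last first.
  rewrite (sector_top ua vb) ?vnth0r; last by rewrite /p; lia.
  case: i si => // i _; rewrite [vnth h i.+1 v](vv i).
  by rewrite vnth0r scaler0 addr0 scaler0.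
under eq_bigr do rewrite add0n binn scale1r expr0 scale1r.
rewrite big_split big_ord_recr big_ord_recl /=.
rewrite (sector_top ua vb) ?vnth0r ?addr0; last by rewrite /p; lia.
rewrite [X in _ + (_ + X)]big1 ?addr0 => [|i _]; last first.
  by rewrite [vnth h _ v](vv i) vnth0r.
rewrite [vnth h 0 v]v0 vnthZr scalerDr scalerA => /eqP; rewrite eq_sym -subr_eq -scalerBl.
rewrite (_ : - _ - _ = s%:R); last first.
  by rewrite -intrM -mulrNz -mulrzBr [in RHS]pmulrn /p; congr (_%:~R); lia.
move=> /eqP E; rewrite -{1}[p - 1 - s%:Z](_ : p - s%:Z - 1 = _); last lia.
rewrite [LHS]E; congr (_ *: _).
by apply: eq_bigr => i _ /=; congr (vnth _ _ (vnth _ _ _)); have := ltn_ord i; lia.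
Qed.

(** On such vectors h(0)^2 = c^2 with c = 2km, nonzero as m > 0, so (c + h(0)) / 2c and (c - h(0)) /
    2c are the projections to the two charges. *)
Lemma sector_split (m : nat) v : (0 < m)%N -> Vw (k * m ^ 2)%N v -> hvac H v ->
  exists vp vn, [/\ v = vp + vn, sector m vp & sector (- m%:Z) vn].
Proof.
move=> m_gt0 mv vv; pose c : K := (2 * k * m)%N%:R.
have c0 : c != 0 by rewrite pnatr_eq0; lia.
have H2 : H 0 (H 0 v) = (c ^+ 2) *: v.
  have := mv; rewrite VwtE conf_sug sugawara1 // => /(congr1 (fun x => (2 * N) *: x)).
  rewrite scalerA mulfV ?scale1r ?mulf_neq0 ?pnatr_eq0 // => ->.
  rewrite scalerA; congr (_ *: _); rewrite /c N_k -natrX -[2 in LHS]/(2%N%:R) -pmulrn -!natrM.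
  by congr (_%:R); lia.
have Hv j : H j.+1%:Z (H 0 v) = 0.
  have /eqP := hcomm j.+1 0 v; rewrite (vv j) raddf0 subr0 addr0 eqz_nat.
  by rewrite scale0r => /eqP.
exists ((2 * c)^-1 *: (c *: v + H 0 v)), ((2 * c)^-1 *: (c *: v - H 0 v)); split.
- rewrite -scalerDr addrACA subrr addr0 -scalerDl scalerA (_ : _ * _ = 1) ?scale1r //.
  by field; rewrite !pnatr_eq0; lia.
- split=> [j|].
    by rewrite (linearZ_LR (H _)) (linearD (H _)) (linearZ_LR (H _)) vv Hv scaler0 addr0 scaler0.
  rewrite (linearZ_LR (H _)) [RHS]scalerA [_ * (2 * c)^-1]mulrC -[RHS]scalerA; congr (_ *: _).
  rewrite (linearD (H _)) (linearZ_LR (H _)) H2 scalerDr scalerA -expr2 addrC.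
  by rewrite (_ : _%:~R = c) // /c pmulrn; congr (_%:~R); lia.
split=> [j|].
  by rewrite (linearZ_LR (H _)) (linearB (H _)) (linearZ_LR (H _)) vv Hv scaler0 subr0 scaler0.
rewrite (linearZ_LR (H _)) [RHS]scalerA [_ * (2 * c)^-1]mulrC -[RHS]scalerA; congr (_ *: _).
rewrite (linearB (H _)) (linearZ_LR (H _)) H2 (_ : _%:~R = - c).
  by rewrite scaleNr scalerBr scalerA opprB expr2.
by rewrite /c [in RHS]pmulrn -[RHS]mulrNz; congr (_%:~R); lia.
Qed.

Lemma sector_vac : sector 0 (vac V).
Proof. by split=> [j|]; rewrite /= vnth_ge0_vac // mulr0 scale0r. Qed.

Lemma sector0 u : sector 0 u -> exists c, u = c *: vac V.
Proof. by move=> /sector_wt; rewrite expr0n mulr0; exact: Vwt0_vac. Qed.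

Lemma star0l a u : star 0 a (vac V) u = u.
Proof. by rewrite /star mulr0 mul0r oppr0 add0r vnth_vac. Qed.

(** * Mutually inverse elements of charge 1 and -1 *)

Section Units.
Hypothesis hvac_level : forall (n : nat) v, Vw n v -> hvac H v -> v != 0 ->
  exists m : nat, n = (k * m ^ 2)%N.
Hypothesis hvac_k : exists v, [/\ Vw k v, hvac H v & v != 0].
Hypothesis V_self : self_contragredient V.

(** Below weight k the vacuum vectors are multiples of 1, and h(0) commutes with the creation
    operators. *)
Lemma h0_low n v : Vw n v -> n < k%:Z -> H 0 v = 0.
Proof.
pose W (m : int) : set V := [set x | m < k%:Z -> H 0 x = 0].
suff VW : forall m u, Vw m u -> W m u by exact: VW.
apply: (hvac_ind N_neq0 hcomm Vwt_subspace heis_wt Vwt_neg) => [m|m u mu uv|m j u _ IH].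
- split=> [_|a x y x0 y0 mk]; first exact: vnth0r.
  by rewrite [LHS](linearP (H 0)) x0 // y0 // scaler0 addr0.
- move=> mk; have [->|u0] := eqVneq u 0; first exact: vnth0r.
  case: m mu mk => [m|m] mu mk; last by move: u0; rewrite (Vwt_neg _ mu) ?eqxx.
  have [[|p] mE] := hvac_level mu uv u0; last by move: mk; rewrite mE; nia.
  move: mu; rewrite mE muln0 => /Vwt0_vac[c ->].
  by rewrite [LHS](linearZ_LR (H 0)) [H 0 (vac V)]vnth_ge0_vac ?scaler0.
move=> mk; have /eqP := hcomm 0 (- j.+1%:Z) u.
rewrite add0r oppr_eq0 eqz_nat /= scale0r subr_eq0 => /eqP ->.
have Hu : H 0 u = 0 by apply: IH; lia.
by rewrite [vnth h 0 u]Hu vnth0r.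
Qed.

Lemma sector_L1 a u : sector a u -> Lvir 1 u = 0.
Proof.
move=> [uv u0]; rewrite L1E conf_sug sugawara_mode.
rewrite (@fsbig_nat_ord _ _ 1) => [|[|i] //= _]; last first.
  by rewrite [vnth h i.+1 u](uv i) [vnth h _ u](uv i.+2) !vnth0r addr0.
rewrite big_ord_recl big_ord0 /= [vnth h (2 + 0) u](uv 1%N) vnth0r add0r addr0.
by rewrite [vnth h 0 u]u0 vnthZr [vnth h _ u](uv 0%N) !scaler0.
Qed.

(** The form yields w of weight k with [u_(2k-1) w = 1]. Applying h(0) to this equation gives
    [u_(2k-1) (h(0) w) = - 2ka 1]. In h(0) w only the two charged vacuum components of w remain, and
    [sector_top] discards the one whose charge is that of u. *)
Lemma unit_pair_sign (a : int) u : sector a u -> u != 0 -> a ^+ 2 = 1 ->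
  exists2 w, sector (- a) w & star a (- a) u w = vac V.
Proof.
move=> ua u0 a2; have [uv uH] := ua.
have ku : Vw k u by have := sector_wt ua; rewrite a2 mulr1.
have [vac0 [w kw uw]] := quasi_primary_pairing V_self ku (sector_L1 ua) u0.
have [w0 [s [r [w0v kw0 ks wE]]]] := hvac_approx N_neq0 hcomm Vwt_subspace heis_wt Vwt_neg kw.
have [wp [wn [w0E p1 n1]]] : exists wp wn, [/\ w0 = wp + wn, sector 1 wp & sector (-1) wn].
  by apply: (@sector_split 1 w0) => //; rewrite exp1n muln1.
(* Each [s j] has weight below k, so h(0) kills the non-vacuum part of w. *)
have Hw : H 0 w = (2 * k)%:R *: (wp - wn).
  rewrite wE raddfD raddf_sum /= big1 => [|j _].
    rewrite addr0 w0E vnthDr [vnth h 0 wp](p1.2) [vnth h 0 wn](n1.2).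
    by rewrite mulr1 mulrN1 mulrNz scaleNr -scalerBr -pmulrn.
  have /eqP := hcomm 0 (- j.+1%:Z) (s j).
  rewrite add0r oppr_eq0 eqz_nat /= scale0r subr_eq0 => /eqP ->.
  by rewrite [vnth h 0 _](h0_low (ks j)) ?vnth0r //; lia.
have := heis_primary_comm 0 (2 * k%:Z - 1) w uv uH.
rewrite uw Hw add0r [H 0 (vac V)]vnth_ge0_vac // sub0r uw vnthZr vnthBr.
have k2 : ((2 * k)%:R : K) != 0 by rewrite pnatr_eq0; lia.
have [aE|aE] : a = 1 \/ a = -1 by nia.
- rewrite aE in ua *; rewrite (sector_top ua p1); last lia.
  rewrite sub0r scalerN opprK mulr1 -pmulrn => /(scalerI k2) E.
  by exists wn => //; rewrite /star -[RHS]E; congr (vnth _ _ _); lia.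
rewrite aE in ua *; rewrite (sector_top ua n1); last lia.
rewrite subr0 mulrN1 mulrNz scaleNr -pmulrn => /oppr_inj /(scalerI k2) E.
by exists wp; rewrite ?opprK // /star -[RHS]E; congr (vnth _ _ _); lia.
Qed.

Lemma unit_pair : exists e f, [/\ sector 1 e, sector (-1) f & star 1 (-1) e f = vac V].
Proof.
have [v [kv vv v0]] := hvac_k.
have [vp [vn [vE p1 n1]]] : exists vp vn, [/\ v = vp + vn, sector 1 vp & sector (-1) vn].
  by apply: (@sector_split 1 v) => //; rewrite exp1n muln1.
have [vp0|vp0] := eqVneq vp 0; last first.
  by have [f f1 ef] := unit_pair_sign p1 vp0 (expr1n _ _); exists vp, f.
have vn0 : vn != 0 by move: v0; rewrite vE vp0 add0r.
have [f f1 ef] := unit_pair_sign n1 vn0 (erefl _); rewrite opprK in f1 ef.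
by exists f, vn; split=> //; rewrite starC.
Qed.

(** * Powers of a generator and its inverse *)

Section Powers.
Variables (e f : V).
Hypotheses (e_sector : sector 1 e) (f_sector : sector (-1) f).
Hypothesis ef1 : star 1 (-1) e f = vac V.

Fixpoint star_pow (a : int) x (n : nat) : V :=
  if n is n'.+1 then star a (a * n'%:Z) x (star_pow a x n') else vac V.

Definition epow (m : int) : V :=
  match m with Posz n => star_pow 1 e n | Negz n => star_pow (-1) f n.+1 end.

Lemma star_pow_sector a x (n : nat) : sector a x -> sector (a * n%:Z) (star_pow a x n).
Proof.
move=> ax; elim: n => [|n IH] /=; first by rewrite mulr0; exact: sector_vac.
by have := star_sector ax IH; congr (sector _ _); lia.
Qed.

Lemma epow_sector m : sector m (epow m).
Proof.
case: m => n; rewrite /epow.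
  by have := star_pow_sector n e_sector; rewrite mul1r.
by have := star_pow_sector n.+1 f_sector; rewrite mulN1r.
Qed.

Lemma fe1 : star (-1) 1 f e = vac V.
Proof. by rewrite starC. Qed.

Lemma epow_neg (n : nat) : epow (- n%:Z) = star_pow (-1) f n.
Proof. by case: n. Qed.

Lemma epowS m : star 1 m e (epow m) = epow (m + 1).
Proof.
case: m => [n|n]; first by rewrite -PoszD addn1 /= mul1r.
rewrite NegzE epow_neg /= -[- n.+1%:Z](_ : -1 + (-1 * n%:Z) = _); last lia.
have fn := star_pow_sector n f_sector.
rewrite -(starA e_sector f_sector fn) ef1 subrr star0l -epow_neg.
by congr epow; lia.
Qed.

Lemma epow_pred m : star (-1) m f (epow m) = epow (m - 1).
Proof.
have -> : m = 1 + (m - 1) by lia.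
rewrite -{2}(_ : m - 1 + 1 = 1 + (m - 1)); last lia.
rewrite -epowS -starA //; [|exact: epow_sector].
by rewrite fe1 addNr star0l; congr epow; lia.
Qed.

Lemma epowD a b : star a b (epow a) (epow b) = epow (a + b).
Proof.
case: a => n.
  elim: n => [|n IH]; first by rewrite add0r star0l.
  rewrite -addn1 PoszD -epowS [n%:Z + 1]addrC starA ?IH ?epowS //; try exact: epow_sector.
  by congr epow; lia.
rewrite NegzE; elim: n.+1 => [|{}n IH]; first by rewrite oppr0 add0r star0l.
have -> : - n.+1%:Z = - n%:Z - 1 by lia.
rewrite -epow_pred [- n%:Z - 1]addrC starA ?IH ?epow_pred //; try exact: epow_sector.
by congr epow; lia.
Qed.

Lemma epow0 : epow 0 = vac V. Proof. by []. Qed.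

Lemma epow_neq0 m : vac V != 0 -> epow m != 0.
Proof.
apply: contraNneq => m0; have := epowD m (- m).
by rewrite m0 subrr epow0 /star vnth0l => <-.
Qed.

(** Multiplication by [epow (- m)] carries u into sector 0, spanned by the vacuum; multiplication by
    [epow m] undoes it. *)
Lemma epow_span m u : sector m u -> exists c, u = c *: epow m.
Proof.
move=> mu; have Em := epow_sector m; have Emn := epow_sector (- m).
have := star_sector Emn mu; rewrite addNr => /sector0[c cE]; exists c.
have := starA Em Emn mu; rewrite epowD subrr epow0 star0l addNr cE => ->.
by rewrite /star vnthZr mulr0 oppr0 add0r vnthN1_vac.
Qed.

End Powers.
Lemma lattice_generators : exists E : int -> V,
  [/\ E 0 = vac V, forall m, sector m (E m), forall m, vac V != 0 -> E m != 0,
      forall a b, star a b (E a) (E b) = E (a + b)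
    & forall m u, sector m u -> exists c, u = c *: E m].
Proof.
have [e [f [e1 f1 ef]]] := unit_pair; exists (epow e f); split=> //.
- by move=> m; exact: epow_sector.
- by move=> m; exact: epow_neq0.
- by move=> a b; exact: epowD.
by move=> m u; exact: epow_span.
Qed.

End Units.
End LatticeSectors.
End HeisenbergField.
End CFT.
End VertexAlgebra.

(** * The lattice vertex operator algebra of a rank-one lattice *)

Lemma sum_count_mem (s : seq nat) (F : nat -> nat) n : {in s, forall j, (j < n)%N} ->
  (\sum_(j <- s) F j = \sum_(i < n) count_mem (i : nat) s * F i)%N.
Proof.
elim: s => [|j s IH] sn; first by rewrite big_nil big1.
rewrite big_cons IH => [|i si]; last by rewrite sn // in_cons si orbT.
have jn : (j < n)%N by rewrite sn ?mem_head.
under [RHS]eq_bigr do rewrite /= mulnDl.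
rewrite big_split; congr (_ + _)%N.
rewrite /= (bigD1 (Ordinal jn)) //= eqxx mul1n big1 ?addn0 // => i.
by rewrite -val_eqE /= eq_sym => /negPf ->.
Qed.

Lemma linearD_eq0 (K : numFieldType) (T : lmodType K) (f g : {linear T -> T}) (x y : T) :
  x = 0 -> y = 0 -> f x + g y = 0.
Proof. by move=> -> ->; rewrite !raddf0 addr0. Qed.

Lemma linear_sum_malg (K : numFieldType) (I : choiceType) (T : lmodType K) (c : K) n
    (t : nat -> {linear {malg K[I]} -> T}) (w : {malg K[I]}) :
  c *: \sum_(i < n) t i w =
  \sum_(x <- msupp w) mcoeff x w *: (c *: \sum_(i < n) t i (mkmalgU x 1)).
Proof.
under eq_bigr => i _ do rewrite {1}[w]malgE linear_sum.
rewrite exchange_big scaler_sumr; apply: eq_bigr => x _ /=.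
rewrite scalerA [_ * c]mulrC -scalerA; congr (_ *: _); rewrite scaler_sumr.
by apply: eq_bigr => i _; rewrite linearZ_LR.
Qed.

Section RankOneLattice.
Variables (L : zmodType) (form : L -> L -> int) (alpha : L).
Hypotheses (L_pos : pos_def_even_lattice form) (L_rank1 : rank_one_basis alpha).

Lemma formC x y : form x y = form y x. Proof. by case: L_pos. Qed.

Lemma formD x y z : form (x + y) z = form x z + form y z. Proof. by case: L_pos. Qed.

Lemma form0 y : form 0 y = 0.
Proof. by apply: (addrI (form 0 y)); rewrite -formD !addr0. Qed.

Lemma formN x y : form (- x) y = - form x y.
Proof. by apply/eqP; rewrite -addr_eq0 -formD addNr form0. Qed.

Lemma formMz x y n : form (x *~ n) y = n * form x y.
Proof.
have Hn (m : nat) : form (x *+ m) y = m%:Z * form x y.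
  elim: m => [|m IH]; first by rewrite mulr0n form0 mul0r.
  by rewrite mulrS formD IH; lia.
case: n => n; first exact: Hn.
by rewrite NegzE mulrNz formN -pmulrn Hn mulNr.
Qed.

Definition coord (b : L) : int := projT1 (cid (L_rank1.2 b)).

Lemma coordE b : b = alpha *~ coord b.
Proof. by rewrite /coord; case: cid. Qed.

Definition half_norm : nat := absz (form alpha alpha %/ 2)%Z.

Lemma form_alpha_gt0 : 0 < form alpha alpha.
Proof. by case: L_pos => _ _ _; apply; case: L_rank1. Qed.

Lemma form_alpha : form alpha alpha = (2 * half_norm)%N%:Z.
Proof.
case: L_pos => _ _ /(_ alpha) /dvdzP[q E] _; have := form_alpha_gt0.
by rewrite /half_norm E mulzK // => q0; lia.
Qed.

Lemma half_norm_gt0 : (0 < half_norm)%N.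
Proof. by have := form_alpha_gt0; rewrite form_alpha; lia. Qed.

Lemma formE b c : form b c = (2 * half_norm)%N%:Z * coord b * coord c.
Proof.
by rewrite [in LHS](coordE b) [in LHS](coordE c) formMz formC formMz form_alpha; lia.
Qed.

Lemma coord_inj : injective coord.
Proof. by move=> b c bc; rewrite (coordE b) bc -coordE. Qed.

Lemma coordMz n : coord (alpha *~ n) = n.
Proof.
have := congr1 (form^~ alpha) (coordE (alpha *~ n)); rewrite /= !formMz => E.
by apply: (mulIf (lt0r_neq0 form_alpha_gt0)).
Qed.

Lemma coordD b c : coord (b + c) = coord b + coord c.
Proof. by rewrite {1}(coordE b) {1}(coordE c) -mulrzDr coordMz. Qed.

Lemma coord_alpha : coord alpha = 1.
Proof. by rewrite -[alpha]mulr1z coordMz. Qed.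

(** The conformal weight (b, b) / 2 of e^b. *)
Definition lat_level (b : L) : nat := (half_norm * `|coord b| ^ 2)%N.

(** As [half_norm] is at least 1, level n forces coordinates between -n and n; [undup] removes the
    second copy of 0. *)
Definition lat_shell (n : nat) : seq L := undup [seq b <- [seq alpha *~ m | m <-
  [seq i%:Z | i <- iota 0 n.+1] ++ [seq - i%:Z | i <- iota 0 n.+1]] | lat_level b == n].

Lemma mem_lat_shell n b : (b \in lat_shell n) = (lat_level b == n).
Proof.
rewrite mem_undup mem_filter; case: eqP => // bn; rewrite andTb.
apply/mapP; exists (coord b); last exact: coordE.
rewrite mem_cat.
have cn : (`|coord b| <= n)%N by rewrite -bn /lat_level; have := half_norm_gt0; nia.
apply/orP; case: (lerP 0 (coord b)) => c0.
  by left; apply/mapP; exists `|coord b|%N; [rewrite mem_iota; lia|lia].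
by right; apply/mapP; exists `|coord b|%N; [rewrite mem_iota; lia|lia].
Qed.

(** * Heisenberg modes and graded dimensions of V_L *)

Section LatticeSpace.
Variable K : numFieldType.
Local Notation W := (lat_space K L).
Local Notation lv := (@lat_vec K L).
Local Notation N := ((form alpha alpha)%:~R : K).
Implicit Types (w : W) (m : {mset nat}%mset) (b : L).

Lemma lat_ext_linear (g : lat_basis L -> W) : linear (lat_ext g).
Proof. exact: (malg_ext_linear g). Qed.

Lemma lat_extE (g : lat_basis L -> W) m b : lat_ext g (lv m b) = g (m, b).
Proof. exact: malg_extU. Qed.

Definition heis_lin n : {linear W -> W} := HB.pack (@heis K L form alpha n)
  (GRing.isLinear.Build K W W _ (@heis K L form alpha n) (lat_ext_linear _)).
Definition exp_vop_lin b n : {linear W -> W} := HB.pack (@exp_vop K L form alpha b n)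
  (GRing.isLinear.Build K W W _ (@exp_vop K L form alpha b n) (lat_ext_linear _)).

Local Notation H := heis_lin.

Lemma heis0r n : heis form alpha n (0 : W) = 0.
Proof. exact: (raddf0 (H n)). Qed.

Lemma heis_neg (j : nat) m b : H (- j.+1%:Z) (lv m b) = lv (j +` m)%mset b.
Proof. by rewrite /= /heis lat_extE /= msetDC. Qed.

Lemma heis_zero m b : H 0 (lv m b) = (form alpha b)%:~R *: lv m b.
Proof. by rewrite /= /heis lat_extE. Qed.

Lemma heis_pos (j : nat) m b :
  H j.+1%:Z (lv m b) = (j.+1%:R * N * (m j)%:R) *: lv (m `\ j)%mset b.
Proof. by rewrite /= /heis lat_extE. Qed.

Lemma lat_linearP (f g : {linear W -> W}) :
  (forall m b, f (lv m b) = g (lv m b)) -> f =1 g.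
Proof. by move=> fg; apply: malg_linearP => -[m b]; exact: fg. Qed.

Lemma exp_coef0 (A : nat -> W -> W) a w : (forall j x, A j x = 0) ->
  exp_coef A a w = if a == 0%N then w else 0.
Proof.
move=> A0; rewrite /exp_coef big_ord_recl /= big1 ?addr0 => [|i _].
  by rewrite fact0 invr1 scale1r.
by rewrite big1 ?scaler0.
Qed.

Lemma exp_vop0 n w : exp_vop form alpha 0 n w = if n == -1 then w else 0.
Proof.
suff E m b : exp_vop form alpha 0 n (lv m b) = if n == -1 then lv m b else 0.
  case: eqP E => n1 E.
    exact: (@lat_linearP (exp_vop_lin 0 n) idfun E).
  exact: (@lat_linearP (exp_vop_lin 0 n) \0 E).
rewrite /exp_vop lat_extE /= form0 add0r.
have h0 n' w' : heis_of form alpha 0 n' w' = 0.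
  by rewrite /heis_of form0 mul0r scale0r.
rewrite (@fsbig_nat_cond _ _ (fun i => 0 <= i%:Z - n - 1 - 0) 1) => [|i i1 _]; last first.
  rewrite /exp_annihilation exp_coef0 => [|j x]; last by rewrite h0 scaler0.
  rewrite (gtn_eqF i1) /exp_creation exp_coef0 => [|j x]; last by rewrite h0 scaler0.
  by case: eqP.
rewrite big_mkcond big_ord_recl big_ord0 /= addr0.
rewrite /exp_annihilation exp_coef0 => [/=|j x]; last by rewrite h0 scaler0.
rewrite /exp_creation exp_coef0 => [/=|j x]; last by rewrite h0 scaler0.
rewrite !subr0 sub0r; case: ifP => n0; last by case: eqP => // e; move: n0; rewrite e.
by rewrite absz_eq0 (_ : (- n - 1 == 0) = (n == -1)) //; apply/eqP/eqP; lia.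
Qed.

Lemma lat_vop_cons j s b n w : lat_vop form alpha (j :: s) b n w =
  \sum_(i \in [set: nat]) 'C(j + i, i)%:R *:
    (heis form alpha (- (j + i).+1%N%:Z) (lat_vop form alpha s b (n + i%:Z) w) +
     (-1) ^+ j *: lat_vop form alpha s b (n - (j + i).+1%N%:Z) (heis form alpha i%:Z w)).
Proof. by []. Qed.

(** The field of alpha(-1) 1 is alpha(z). As Y(1, z) is the identity, one summand survives: a
    creation term of index |n| - 1 if n < 0, an annihilation term of index n otherwise. *)
Lemma lat_vop1 n w : lat_vop form alpha [:: 0%N] 0 n w = H n w.
Proof.
pose F i := heis form alpha (- i.+1%:Z) (if n + i%:Z == -1 then w else 0) +
  (if n - i.+1%:Z == -1 then heis form alpha i%:Z w else 0).
have [p pn [F0 Fp]] : exists2 p : nat, (p < `|n|.+1)%N &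
    (forall i, i != p -> F i = 0) /\ F p = heis form alpha n w.
  exists (if n is Posz q then q else `|n|.-1)%N; first by case: (n) => q; lia.
  split=> [i i0|]; rewrite /F.
    case: eqP => [|_]; first by case: (n) i0 => q; lia.
    case: eqP => [|_]; first by case: (n) i0 => q; lia.
    by rewrite heis0r addr0.
  case: (n) => q; last first.
    case: eqP => [_|]; last lia.
    case: eqP => [|_]; first lia.
    by rewrite addr0; congr (heis _ _ _ _); lia.
  case: eqP => [|_]; first lia.
  by case: eqP => [_|]; [rewrite heis0r add0r|lia].
have -> : lat_vop form alpha [:: 0%N] 0 n w = \sum_(i \in [set: nat]) F i.
  apply: eq_fsbigr => i _.
  by rewrite binn scale1r expr0 scale1r /F /= !exp_vop0.
rewrite (@fsbig_nat_ord _ _ `|n|.+1) => [|i ni]; last by apply: F0; lia.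
by rewrite (bigD1 (Ordinal pn)) //= big1 ?addr0 // => i ip; apply: F0.
Qed.

Local Notation VL := (lattice_voa K form alpha).

Lemma lattice_vnthU m b n w : @vnth K VL (lv m b) n w = lat_vop form alpha m b n w.
Proof. exact: (malg_extU (fun x : lat_basis L => lat_vop form alpha (enum_mset x.1) x.2 n w)). Qed.

Fact lattice_vnth_linear_l n w : linear (fun u : W => @vnth K VL u n w).
Proof.
exact: (malg_ext_linear (fun x : lat_basis L => lat_vop form alpha (enum_mset x.1) x.2 n w)).
Qed.

Definition lattice_lmode n w : {linear W -> W} := HB.pack (fun u : W => @vnth K VL u n w)
  (GRing.isLinear.Build K W W _ (fun u : W => @vnth K VL u n w) (lattice_vnth_linear_l n w)).

(** Over all i, each alpha(-j) alpha(j) with j > 0 occurs twice and alpha(0)^2 once, in accordance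
    with the prefactor 1 / 2N of L(0). *)
Let L0_term (i : nat) : {linear W -> W} :=
  (H (- i.+1%:Z) \o H (1 + i%:Z)) \+ (H (1 - i.+1%:Z) \o H i%:Z).

Let L0_termS i w :
  L0_term i.+1 w = H (- i.+2%:Z) (H i.+2%:Z w) + H (- i.+1%:Z) (H i.+1%:Z w).
Proof.
suff E p q : 1 + i.+1%:Z = p -> 1 - i.+2%:Z = q ->
  L0_term i.+1 w = H (- i.+2%:Z) (H p w) + H q (H i.+1%:Z w) by apply: E; lia.
by move=> <- <-.
Qed.

Let L0_term0 w : L0_term 0 w = H (- 1%:Z) (H 1%:Z w) + H 0 (H 0 w).
Proof. by []. Qed.

Lemma lattice_conf1 w : @vnth K VL (conf VL) 1 w =
  (2%:R * N)^-1 *: \sum_(i \in [set: nat]) L0_term i w.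
Proof.
apply: etrans (linearZ_LR (lattice_lmode 1 w) _ _) _; congr (_ *: _).
apply: etrans (lattice_vnthU _ _ _ _) _; rewrite enum_msetn.
rewrite lat_vop_cons; apply: eq_fsbigr => i _.
by rewrite binn scale1r expr0 scale1r !lat_vop1.
Qed.

Lemma lattice_L0 m b :
  @vnth K VL (conf VL) 1 (lv m b) = (mwt m + lat_level b)%N%:R *: lv m b.
Proof.
have m_bd : {in enum_mset m, forall j, (j < mwt m)%N}.
  by move=> j jm; rewrite /mwt (big_rem j jm) /=; lia.
have m0 j : (mwt m <= j)%N -> m j = 0%N.
  by move=> Mj; apply/mset_eq0P/negP => /m_bd; lia.
have T (i : nat) : H (- i.+1%:Z) (H i.+1%:Z (lv m b)) = ((m i * i.+1)%N%:R * N) *: lv m b.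
  rewrite heis_pos linearZ_LR heis_neg natrM.
  have [im|/mset_eq0P mi0] := boolP (i \in m).
    by rewrite (msetB1K im) mulrAC [_ * (m i)%:R]mulrC.
  rewrite mi0 mulr0n mulr0 !mul0r.
  exact: etrans (scale0r _) (esym (scale0r _)).
(* [t i] is the eigenvalue of alpha(-(i+1)) alpha(i+1), and [g i] that of [L0_term i]; the [t i] add
   up to [mwt m] times N. *)
pose t (i : nat) : K := (m i * i.+1)%N%:R * N.
pose g (i : nat) : K := t i + (if i is i'.+1 then t i' else (form alpha b)%:~R ^+ 2).
have FE i : L0_term i (lv m b) = g i *: lv m b.
  apply: etrans (esym (scalerDl _ _ _)); case: i => [|i]; last first.
    exact: etrans (L0_termS i (lv m b)) (congr2 +%R (T i.+1) (T i)).
  apply: etrans (L0_term0 (lv m b)) (congr2 +%R (T 0%N) _).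
  rewrite (heis_zero m b) (linearZ_LR (H 0)) (heis_zero m b).
  exact: scalerA.
have g0 i : ((mwt m).+1 <= i)%N -> g i = 0.
  by case: i => // i im; rewrite /g /t !m0 ?mul0n ?mul0r ?addr0 //; lia.
have S_mwt n : (mwt m <= n)%N -> \sum_(i < n) t i = (mwt m)%:R * N.
  move=> mn; rewrite /t -mulr_suml -natr_sum; congr (_%:R * _).
  rewrite [in RHS]/mwt (@sum_count_mem _ _ n) => [|j /m_bd]; last lia.
  by apply: eq_bigr => i _; rewrite count_mem_mset.
have S_g : \sum_(i < (mwt m).+1) g i = (mwt m)%:R * N + (form alpha b)%:~R ^+ 2 + (mwt m)%:R * N.
  by rewrite /g big_split /= S_mwt ?leqnSn // big_ord_recl /= S_mwt // addrA.
have fsE : \sum_(i \in [set: nat]) L0_term i (lv m b) = (\sum_(i < (mwt m).+1) g i) *: lv m b.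
  apply: etrans (@fsbig_nat_ord _ _ (mwt m).+1 _) _ => [i im|].
    by apply: etrans (FE i) _; rewrite (g0 i im); exact: scale0r.
  apply: etrans (eq_bigr _ _) (esym (scaler_suml _ _ _ _)) => i _; exact: FE.
apply: etrans (lattice_conf1 (lv m b)) _.
apply: etrans (congr1 _ fsE) _; apply: etrans (scalerA _ _ _) _; rewrite S_g.
apply: (congr1 (fun c : K => c *: lv m b)).
rewrite !formE coord_alpha !mulr1 !intrM natrD /lat_level natrM natrX.
have -> : (`|coord b|%:R : K) ^+ 2 = (coord b)%:~R ^+ 2.
  by case: (coord b) => n //; rewrite NegzE abszN absz_nat mulrNz sqrrN.
rewrite -pmulrn natrM; field.
by rewrite pnatr_eq0 -lt0n half_norm_gt0.
Qed.

(** How far the normally ordered sum extends depends on the vector. [M] bounds it at once for [w]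
    and for the basis vectors in its support, so a single finite sum of linear operators serves them
    all. *)
Lemma lattice_L0_sum w : @vnth K VL (conf VL) 1 w =
  \sum_(x <- msupp w) mcoeff x w *: ((mwt x.1 + lat_level x.2)%N%:R *: (mkmalgU x 1 : W)).
Proof.
pose M := (\max_(x <- msupp w) mwt (x : lat_basis L).1)%N.
have L0_fin (u : W) : (forall i, (M <= i)%N -> H i.+1%:Z u = 0) ->
    @vnth K VL (conf VL) 1 u = (2%:R * N)^-1 *: \sum_(i < M.+1) L0_term i u.
  move=> u0; apply: etrans (lattice_conf1 u) _; congr (_ *: _).
  apply: fsbig_nat_ord => -[//|i] Mi; apply: etrans (L0_termS i u) _.
  exact: linearD_eq0 (u0 i.+1 (leqW Mi)) (u0 i Mi).
have basis0 m b i : (m, b) \in msupp w -> (M <= i)%N -> H i.+1%:Z (lv m b) = 0.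
  move=> mbw Mi; apply: etrans (heis_pos i m b) _.
  have /mset_eq0P -> : i \notin m; last by rewrite mulr0; exact: scale0r.
  apply/negP => im; have : (mwt m <= M)%N by rewrite /M (big_rem _ mbw) leq_maxl.
  by rewrite /mwt (big_rem i im) /=; lia.
have w0 i : (M <= i)%N -> H i.+1%:Z w = 0.
  move=> Mi; rewrite {1}[w]malgE (linear_sum (H _)) big_seq big1 // => -[m b] xw.
  apply: etrans (linearZ_LR (H _) _ _) _; apply: etrans (congr1 _ (basis0 _ _ _ xw Mi)) _.
  exact: scaler0.
apply: etrans (L0_fin w w0) _; apply: etrans (linear_sum_malg _ _ _ _) _.
apply: eq_big_seq => -[m b] xw; apply: (congr1 (fun v : W => mcoeff _ w *: v)).
exact: etrans (esym (L0_fin (lv m b) (fun i => basis0 m b i xw))) (lattice_L0 m b).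
Qed.

Lemma lattice_has_dim (n : nat) : has_dim (@wtspace K VL (adjoint VL) n%:R)
  (\sum_(j < n.+1) size (parts (n - j)) * size (lat_shell j))%N.
Proof.
rewrite -(size_fock_idx mem_lat_shell).
pose X := fock_idx lat_level lat_shell n.
have X_uniq : uniq X by apply: fock_idx_uniq (fun n => undup_uniq _) mem_lat_shell _.
have memX x : (x \in X) = (mwt x.1 + lat_level x.2 == n)%N := mem_fock_idx mem_lat_shell n x.
apply: (@has_dim_seq _ _ _ X (fun x => mkmalgU x 1 : W)) => // [[m b]|w|a a0 x xX].
- by rewrite memX => /eqP mn; rewrite /wtspace /= [LHS]lattice_L0 mn.
- rewrite /wtspace /= => L0w; exists (fun x => mcoeff x w).
  apply/malgP => y; rewrite mcoeff_sumU //; case: ifPn => // yX.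
  apply/eqP; rewrite mcoeff_eq0; apply: contra yX => yw; rewrite memX.
  have := congr1 (mcoeff y) L0w; rewrite [X in mcoeff y X](lattice_L0_sum w).
  under eq_bigr do rewrite scalerA; rewrite mcoeff_sumU ?fset_uniq // yw mcoeffZ mulrC.
  have wy0 : mcoeff y w != 0 by rewrite mcoeff_neq0.
  by move/(mulIf wy0)/eqP; rewrite eqr_nat.
have := mcoeff_sumU a x X_uniq; rewrite xX => <-.
by rewrite a0 mcoeff0.
Qed.

End LatticeSpace.
End RankOneLattice.

(** * Counting vacuum vectors *)

Lemma has_dim_neq0 (K : numFieldType) (M : lmodType K) (S : set M) n :
  has_dim S n -> (0 < n)%N -> exists2 v, S v & v != 0.
Proof.
move=> /has_dimP[b [Sb b_free _]] n0; exists (b (Ordinal n0)) => //.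
apply/eqP => b0.
have S0 : \sum_i (i == Ordinal n0)%:R *: b i = 0.
  by rewrite (bigD1 (Ordinal n0)) //= b0 scaler0 add0r big1 // => i /negPf ->; rewrite scale0r.
by have /eqP := b_free _ S0 (Ordinal n0); rewrite eqxx oner_eq0.
Qed.

Lemma has_dim0 (K : numFieldType) (M : lmodType K) (S : set M) v :
  has_dim S 0 -> S v -> v = 0.
Proof. by move=> /has_dimP[b [_ _ b_gen]] /b_gen[a ->]; rewrite big_ord0. Qed.

Lemma eigen_free (K : numFieldType) (V : lmodType K) (I : choiceType) (D : {linear V -> V})
    (beta : I -> V) (mu : I -> K) : injective mu -> (forall i, beta i != 0) ->
  (forall i, D (beta i) = mu i *: beta i) -> free_family beta.
Proof.
move=> mu_inj b0 Db a X; elim: X a => [|x X IH] a //= /andP[xX X_uniq] aX0.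
have aX i : i \in X -> a i = 0.
  move=> iX; have := congr1 (fun v => D v - mu x *: v) aX0.
  rewrite /= linear_sum scaler_sumr raddf0 scaler0 subrr -sumrB big_cons.
  rewrite linearZ_LR Db !scalerA [mu x * _]mulrC subrr add0r => S0.
  have /IH/(_ i iX) : \sum_(j <- X) (a j * (mu j - mu x)) *: beta j = 0.
    rewrite -[RHS]S0; apply: eq_bigr => j _.
    by rewrite linearZ_LR Db !scalerA -scalerBl mulrBr [mu x * _]mulrC.
  move=> /(_ X_uniq)/eqP; rewrite mulf_eq0 subr_eq0 => /orP[/eqP //|/eqP/mu_inj ix].
  by rewrite -ix iX in xX.
move=> i; rewrite in_cons => /orP[/eqP ->|/aX //].
move: aX0; rewrite big_cons big_seq big1 ?addr0 => [/eqP|j /aX ->]; last by rewrite scale0r.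
by rewrite scaler_eq0 (negPf (b0 x)) orbF => /eqP.
Qed.

Section GradedFree.
Variables (K : numFieldType) (V : lmodType K) (I : choiceType) (beta : I -> V).
Variables (Vg : nat -> set V) (lv : I -> nat) (B : nat -> seq I).
Hypothesis Vg_subspace : forall n, is_subspace (Vg n).
Hypothesis Vg_indep : forall M (f : nat -> V), (forall n, Vg n (f n)) ->
  \sum_(n < M) f n = 0 -> forall n, (n < M)%N -> f n = 0.
Hypothesis B_uniq : forall n, uniq (B n).
Hypothesis mem_B : forall n i, (i \in B n) = (lv i == n).
Hypothesis beta_lv : forall i, Vg (lv i) (beta i).
Hypothesis beta_free : forall n (a : I -> K),
  \sum_(i <- B n) a i *: beta i = 0 -> {in B n, forall i, a i = 0}.

(** The coefficients are extended by 0 to all indices of level at most [M], so that the relation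
    splits into its weight components. *)
Lemma graded_free : free_family beta.
Proof.
move=> a X X_uniq aX0; pose c i := if i \in X then a i else 0.
pose M := (\max_(i <- X) lv i)%N.
have lvM i : i \in X -> (lv i <= M)%N by move=> iX; rewrite /M (big_rem i iX) leq_maxl.
have sum_upto n : \sum_(i <- lvl_upto B n) c i *: beta i =
    \sum_(j < n.+1) \sum_(i <- B j) c i *: beta i.
  elim: n => [|n IH] /=; first by rewrite big_ord_recl big_ord0 addr0.
  by rewrite big_cat IH [in RHS]big_ord_recr.
have S0 : \sum_(j < M.+1) \sum_(i <- B j) c i *: beta i = 0.
  rewrite -sum_upto -[RHS]aX0 (bigID (mem X)) /= [X in _ + X]big1 ?addr0; last first.
    by move=> i /negPf iX; rewrite /c iX scale0r.
  rewrite -big_filter (perm_big X) /=; last first.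
    apply: uniq_perm => [||i] //; first exact/filter_uniq/lvl_upto_uniq.
    rewrite mem_filter; case: (boolP (i \in X)) => //= iX.
    by rewrite (mem_lvl_upto mem_B) lvM.
  by rewrite big_seq [RHS]big_seq; apply: eq_bigr => i iX; rewrite /c iX.
move=> i iX.
have /Vg_indep/(_ S0 (lv i)) : forall n, Vg n (\sum_(i <- B n) c i *: beta i).
  move=> n; rewrite big_seq; apply: subspace_sum => // j; rewrite mem_B => /eqP <-.
  exact: subspaceZ.
rewrite ltnS lvM // => /(_ isT)/beta_free/(_ i); rewrite mem_B eqxx /c iX.
exact.
Qed.

End GradedFree.

Section CountingVacua.
Variables (K : numFieldType) (V : voaData K).
Hypotheses (V_voa : is_voa V) (V_cft : CFT_type V).
Variables (h : V) (N : K).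
Hypothesis h_wt : @Vwt K V 1 h.
Hypothesis h_norm : vnth h 1 h = N *: vac V.
Hypothesis N_neq0 : N != 0.
Variable ell : nat -> nat.
Hypothesis V_dim : forall n : nat, has_dim (@Vwt K V n)
  (\sum_(j < n.+1) size (parts (n - j)) * ell j)%N.

Local Notation H := (mode V_voa h).

Lemma Vwt_indep M (f : nat -> V) : (forall n : nat, @Vwt K V n (f n)) ->
  \sum_(n < M) f n = 0 -> forall n, (n < M)%N -> f n = 0.
Proof.
move=> Vf S0 n nM; case: V_voa => _ _ _ _ [[_ _ indep] _ _].
have := indep [seq k%:Z | k <- iota 0 M] (fun m => if m is Posz k then f k else 0) _ _ _ n%:Z.
apply.
- by rewrite map_inj_uniq ?iota_uniq // => x y [].
- by move=> [m|m] //; case: (Vwt_subspace V_voa (Negz m)).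
- by rewrite big_map -[in RHS]S0 -(big_mkord xpredT f) /index_iota subn0.
by apply/mapP; exists n; rewrite ?mem_iota.
Qed.

(** With a basis of vacuum vectors chosen in each weight, [fock_has_dim] computes dim V_n from the
    unknown dimensions [om]; cancelling the partition series against [V_dim] identifies [om] with
    [ell]. *)
Lemma hvac_has_dim (n : nat) : has_dim (@Vwt K V n `&` hvac H) (ell n).
Proof.
pose Om (n : nat) := @Vwt K V n `&` hvac H.
have Om_sub j : is_subspace (Om j).
  have [V0 VD] := Vwt_subspace V_voa j; have [h0 hD] := hvac_subspace H.
  split=> [|c u v [Vu hu] [Vv hv]]; first by split.
  by split; [exact: VD|exact: hD].
have Om_fin j : fin_dim (Om j).
  by apply: fin_dim_sub (Vwt_fin_dim V_voa j) => // v [].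
pose om j := Defs.dim (Om j).
have Om_dim j : has_dim (Om j) (om j) by exact: fin_dim_dim.
pose b j := projT1 (cid (iffLR (has_dimP _ _) (Om_dim j))).
have bP j : [/\ forall i, Om j (b j i), free_fam (b j) &
    forall v, Om j v -> exists a : 'I_(om j) -> K, v = \sum_i a i *: b j i].
  by rewrite /b; case: cid.
pose I : choiceType := {j : nat & 'I_(om j)}.
pose beta (i : I) := b (tag i) (tagged i).
pose B j : seq I := [seq Tagged (fun j => 'I_(om j)) i | i <- enum 'I_(om j)].
have B_uniq j : uniq (B j).
  by rewrite map_inj_uniq ?enum_uniq // => x y /eqP; rewrite eq_Tagged => /eqP.
have mem_B j (i : I) : (i \in B j) = (tag i == j).
  apply/mapP/eqP => [[k _ ->] //|<-]; exists (tagged i); rewrite ?mem_enum //.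
  by case: (i).
have sumB j (a : I -> K) : \sum_(i <- B j) a i *: beta i =
    \sum_k a (Tagged (fun j => 'I_(om j)) k) *: b j k.
  by rewrite big_map big_enum.
have beta_Om i : Om (tag i) (beta i) by case: (bP (tag i)) => Omb _ _; exact: Omb.
have beta_vac i : hvac H (beta i) by case: (beta_Om i).
have beta_wt (i : I) : @Vwt K V (tag i) (beta i) by case: (beta_Om i).
have beta_free : free_family beta.
  apply: (@graded_free _ _ _ _ (fun n : nat => @Vwt K V n) (fun i : I => tag i) B) => //.
  - by move=> j; exact: Vwt_subspace.
  - exact: Vwt_indep.
  move=> j a; rewrite sumB => a0 [j' k]; rewrite mem_B => /eqP /= ij; subst j'.
  by have [_ bf _] := bP j; exact: bf a0 k.
have hcomm := heis_comm V_voa V_cft h_wt h_norm N_neq0.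
have Vdim' (k : nat) : has_dim (@Vwt K V k) (\sum_(j < k.+1) size (parts (k - j)) * om j)%N.
  have := fock_has_dim N_neq0 hcomm beta_vac beta_free (Vwt_subspace V_voa)
    (heis_wt V_voa h_wt N_neq0) (Vwt_neg V_cft) B_uniq mem_B beta_wt.
  move=> Hdim; have := Hdim _ k; under eq_bigr do rewrite size_map size_enum_ord.
  apply=> j v Vv hv; have [_ _ /(_ v)[//|a ->]] := bP j.
  (* Coordinates in weight j, transported along [tag i = j] and set to 0 at other weights. *)
  exists (fun i : I => if tag i =P j is ReflectT e then a (ecast j 'I_(om j) e (tagged i)) else 0).
  rewrite sumB; apply: eq_bigr => i _ /=; case: eqP => // e.
  by rewrite (eq_axiomK e).
suff <- : om n = ell n by exact: Om_dim.
apply: (@fock_count_inj (fun k => size (parts k)) om ell size_parts0) => k.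
exact: has_dim_uniq (Vdim' k) (V_dim k).
Qed.

End CountingVacua.

(** * Coefficients of operator exponentials *)

Lemma triangle_swap (M : nmodType) (F : nat -> nat -> M) a :
  \sum_(1 <= j < a.+1) \sum_(1 <= i < (a - j).+1) F i j =
  \sum_(1 <= i < a.+1) \sum_(1 <= j < (a - i).+1) F i j.
Proof.
have widen (G : nat -> nat -> M) : \sum_(1 <= j < a.+1) \sum_(1 <= i < (a - j).+1) G i j =
    \sum_(1 <= j < a.+1) \sum_(1 <= i < a.+1 | (i + j <= a)%N) G i j.
  apply: eq_big_nat => j /andP[j1 ja].
  rewrite (big_nat_widen _ _ a.+1) /=; last lia.
  by rewrite big_nat_cond [RHS]big_nat_cond; apply: eq_bigl => i; lia.
rewrite widen (widen (fun i j => F j i)) (exchange_big_dep_nat predT) //=.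
by apply: eq_bigr => i _; apply: eq_bigl => j; rewrite addnC.
Qed.

Section ExpCoefficients.
Variables (K : numFieldType) (W : lmodType K).

(* [pow_coef] and [exp_coef] over an arbitrary module. *)
Fixpoint mpow_coef (A : nat -> W -> W) (r a : nat) (w : W) : W :=
  if r is r'.+1 then \sum_(1 <= j < a.+1) A j (mpow_coef A r' (a - j)%N w)
  else if a == 0%N then w else 0.

Definition mexp_coef (A : nat -> W -> W) (a : nat) (w : W) : W :=
  \sum_(r < a.+1) ((r`!)%:R)^-1 *: mpow_coef A r a w.

Variable A : nat -> {linear W -> W}.
Hypothesis A_comm : forall i j w, (0 < i)%N -> (0 < j)%N -> A i (A j w) = A j (A i w).
Local Notation P := (mpow_coef (fun j w => A j w)).
Local Notation E := (mexp_coef (fun j w => A j w)).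

Lemma pow_coefS r a w : P r.+1 a w = \sum_(1 <= j < a.+1) A j (P r (a - j) w).
Proof. by []. Qed.

Lemma pow_coef_small r a w : (a < r)%N -> P r a w = 0.
Proof.
elim: r a => [|r IH] a // ar; rewrite pow_coefS big_nat big1 // => j /andP[j1 ja].
by rewrite IH ?raddf0 //; lia.
Qed.

(** The coefficients of x d/dx A(x)^r = r (x A'(x)) A(x)^(r-1), valid because the A_j commute. *)
Lemma pow_coef_rec r a w : a%:R *: P r a w =
  r%:R *: \sum_(1 <= j < a.+1) j%:R *: A j (P r.-1 (a - j) w).
Proof.
elim: r a => [|r IH] a.
  by rewrite scale0r /=; case: a => [|a]; rewrite ?scale0r ?scaler0.
rewrite pow_coefS [LHS]scaler_sumr.
transitivity (\sum_(1 <= j < a.+1) j%:R *: A j (P r (a - j) w) +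
    \sum_(1 <= j < a.+1) A j ((a - j)%:R *: P r (a - j) w)).
  rewrite -big_split /=; apply: eq_big_nat => j /andP[j1 ja].
  by rewrite linearZ_LR -scalerDl -natrD subnKC.
rewrite -[r.+1 in RHS]add1n natrD scalerDl scale1r /=; congr (_ + _).
under eq_bigr do rewrite IH linearZ_LR linear_sum.
rewrite -scaler_sumr; case: r IH => [|r] IH; first by rewrite !scale0r.
congr (_ *: _); rewrite triangle_swap; apply: eq_big_nat => i /andP[i1 ia].
rewrite pow_coefS linear_sum scaler_sumr; apply: eq_big_nat => j /andP[j1 ja] /=.
rewrite linearZ_LR A_comm //; congr (_ *: A _ (A _ (P _ _ _))); lia.
Qed.

Lemma exp_coefE n a w : (a <= n)%N -> E a w = \sum_(r < n.+1) (r`!%:R)^-1 *: P r a w.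
Proof.
move=> an; rewrite /mexp_coef -!(big_mkord xpredT (fun r => (r`!%:R)^-1 *: P r a w)).
rewrite [RHS](@big_cat_nat _ _ _ a.+1) //= [X in _ = _ + X](_ : _ = 0) ?addr0 //.
by rewrite big_nat big1 // => r /andP[ar _]; rewrite pow_coef_small ?scaler0.
Qed.

Lemma exp_coef_0 w : E 0 w = w.
Proof. by rewrite /mexp_coef big_ord_recl big_ord0 /= invr1 scale1r addr0. Qed.

(** The coefficients of x d/dx exp A(x) = (x A'(x)) exp A(x). *)
Lemma exp_coef_rec a w : a%:R *: E a w = \sum_(1 <= j < a.+1) j%:R *: A j (E (a - j) w).
Proof.
have -> : \sum_(1 <= j < a.+1) j%:R *: A j (E (a - j) w) =
    \sum_(1 <= j < a.+1) \sum_(r < a.+1) (r`!%:R)^-1 *: (j%:R *: A j (P r (a - j) w)).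
  apply: eq_big_nat => j /andP[j1 ja]; rewrite (@exp_coefE a) ?leq_subr // linear_sum scaler_sumr.
  by apply: eq_bigr => r _; rewrite linearZ_LR !scalerA mulrC.
rewrite exchange_big /= (@exp_coefE a.+1) ?leqnSn // scaler_sumr big_ord_recl /=.
rewrite [X in X + _](_ : _ = 0) ?add0r; last first.
  by case: a => [|a]; rewrite ?scale0r ?scaler0 ?scaler0.
apply: eq_bigr => r _; rewrite scalerA [a%:R * _]mulrC -scalerA -scaler_sumr.
rewrite (_ : a%:R *: _ = r.+1%:R *: \sum_(1 <= j < a.+1) j%:R *: A j (P r (a - j) w)); last first.
  exact: (pow_coef_rec r.+1).
rewrite scalerA; congr (_ *: _).
by rewrite /bump factS natrM invfM mulrAC mulVf ?mul1r // pnatr_eq0.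
Qed.

Lemma exp_coef_uniq (X : nat -> W) w : X 0%N = w ->
  (forall a, a%:R *: X a = \sum_(1 <= j < a.+1) j%:R *: A j (X (a - j)%N)) ->
  forall a, X a = E a w.
Proof.
move=> X0 X_rec; elim/ltn_ind => -[|a] IH; first by rewrite exp_coef_0.
have a0 : (a.+1%:R : K) != 0 by rewrite pnatr_eq0.
apply: (scalerI a0); rewrite X_rec exp_coef_rec; apply: eq_big_nat => j /andP[j1 ja].
by rewrite IH //; lia.
Qed.

(** If [D, A(x)] is the scalar c x^p, then [D, exp A(x)] = c x^p exp A(x). *)
Lemma exp_coef_comm (D : {linear W -> W}) (c : K) p w : (0 < p)%N ->
  (forall i v, (0 < i)%N -> D (A i v) = A i (D v) + (if i == p then c else 0) *: v) ->
  forall a, D (E a w) = E a (D w) + (if (p <= a)%N then c *: E (a - p) w else 0).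
Proof.
move=> p0 DA; elim/ltn_ind => -[|a] IH.
  by rewrite !exp_coef_0 leqn0 (gtn_eqF p0) addr0.
have a0 : (a.+1%:R : K) != 0 by rewrite pnatr_eq0.
apply: (scalerI a0); rewrite -linearZ_LR exp_coef_rec linear_sum scalerDr exp_coef_rec.
(* The correction arises twice: from the induction hypothesis, with total factor a + 1 - p, and from
   D crossing [A p], with factor p. Together they give a + 1. *)
have -> : \sum_(1 <= j < a.+2) D (j%:R *: A j (E (a.+1 - j) w)) =
    \sum_(1 <= j < a.+2) j%:R *: A j (E (a.+1 - j) (D w)) +
    (\sum_(1 <= j < a.+2) 
      (if (j + p <= a.+1)%N then c *: (j%:R *: A j (E (a.+1 - p - j) w)) else 0) +
    \sum_(1 <= j < a.+2) (if j == p then (p%:R * c) *: E (a.+1 - p) w else 0)).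
  rewrite -!big_split /=; apply: eq_big_nat => j /andP[j1 ja].
  rewrite linearZ_LR DA // IH; last lia.
  rewrite (linearD (A j)) !scalerDr -addrA; congr (_ + (_ + _)).
    rewrite (_ : (p <= a.+1 - j)%N = (j + p <= a.+1)%N); last by apply/idP/idP; lia.
    case: ifP => jp; last by rewrite linear0 scaler0.
    by rewrite linearZ_LR !scalerA mulrC; congr (_ *: A _ (E _ _)); lia.
  by case: eqP => [->|_]; rewrite ?scale0r ?scaler0 // scalerA.
congr (_ + _); rewrite -big_mkcond.
have -> : \sum_(1 <= j < a.+2 | (j + p <= a.+1)%N) c *: (j%:R *: A j (E (a.+1 - p - j) w)) =
    if (p <= a.+1)%N then c *: ((a.+1 - p)%:R *: E (a.+1 - p) w) else 0.
  case: ifP => pa; last by rewrite big_nat_cond big1 // => j; lia.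
  rewrite exp_coef_rec scaler_sumr [RHS](big_nat_widen _ _ a.+2) /=; last lia.
  by rewrite big_nat_cond [RHS]big_nat_cond; apply: eq_bigl => j; lia.
case: ifP => pa; last first.
  by rewrite scaler0 add0r big_nat big1 // => j ja; case: eqP => // jp; lia.
rewrite -big_mkcond big_nat1_eq p0 ltnS pa /= !scalerA -scalerDl; congr (_ *: _).
by rewrite [p%:R * c]mulrC -mulrDr -natrD subnK // mulrC.
Qed.

End ExpCoefficients.

(** * Vertex operators on Heisenberg modules *)

Section ExponentialOperators.
Variables (K : numFieldType) (W : lmodType K) (H : int -> {linear W -> W}) (N : K).
Hypothesis H_comm : forall m n v,
  H m (H n v) - H n (H m v) = (if m + n == 0 then m%:~R * N else 0) *: v.
Variable rho : K.

Let creA j : {linear W -> W} := (j%:R^-1 \*: (rho \*: H (- j%:Z))).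
Let annA j : {linear W -> W} := (- (j%:R^-1) \*: (rho \*: H j%:Z)).

(** The exponentials of the lattice construction for b = rho alpha, over any Heisenberg module, so
    that V_L and V are covered together. *)
Definition exp_cre := mexp_coef (fun j (w : W) => j%:R^-1 *: (rho *: H (- j%:Z) w)).
Definition exp_ann := mexp_coef (fun j (w : W) => - (j%:R^-1) *: (rho *: H j%:Z w)).

Let creA_comm i j w : (0 < i)%N -> (0 < j)%N -> creA i (creA j w) = creA j (creA i w).
Proof.
move=> i0 j0; rewrite /creA /= !(linearZ_LR (H _)) /= (h_swap H_comm); last lia.
by rewrite !scalerA; congr (_ *: _); ring.
Qed.

Let annA_comm i j w : (0 < i)%N -> (0 < j)%N -> annA i (annA j w) = annA j (annA i w).
Proof.
move=> i0 j0; rewrite /annA /= !(linearZ_LR (H _)) /= (h_swap H_comm); last lia.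
by rewrite !scalerA; congr (_ *: _); ring.
Qed.

Let exp_cre_0 w : exp_cre 0 w = w. Proof. exact: (exp_coef_0 creA w). Qed.
Let exp_ann_0 w : exp_ann 0 w = w. Proof. exact: (exp_coef_0 annA w). Qed.

Let exp_cre_rec a w :
  a%:R *: exp_cre a w = \sum_(1 <= j < a.+1) j%:R *: creA j (exp_cre (a - j) w).
Proof. exact: (exp_coef_rec creA_comm). Qed.

Lemma exp_cre_lin a : linear (exp_cre a).
Proof.
move=> c u v; apply/esym; pose X a := c *: exp_cre a u + exp_cre a v.
apply: (exp_coef_uniq creA_comm (X := X)) => [|{}a].
  by rewrite /X !exp_cre_0.
rewrite /X scalerDr scalerA mulrC -scalerA.
rewrite !exp_cre_rec scaler_sumr -big_split /=.
apply: eq_bigr => j _.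
by rewrite (linearP (H _)) !scalerDr !scalerA; congr (_ *: _ + _ *: _); ring.
Qed.

Let exp_cre_linear a : {linear W -> W} := HB.pack (exp_cre a)
  (GRing.isLinear.Build K W W _ (exp_cre a) (exp_cre_lin a)).

Lemma exp_cre_comm p a w : exp_cre a (H (- p.+1%:Z) w) = H (- p.+1%:Z) (exp_cre a w).
Proof.
rewrite [RHS](exp_coef_comm creA_comm (D := H (- p.+1%:Z)) (c := 0) (p := 1%N)) //.
  by rewrite scale0r if_same addr0.
move=> i v i0; rewrite if_same scale0r addr0 /creA /= !(linearZ_LR (H _)) /=.
rewrite (h_swap H_comm) //; lia.
Qed.

Lemma exp_ann_comm p a w : exp_ann a (H (- p.+1%:Z) w) = H (- p.+1%:Z) (exp_ann a w) -
  (if (p.+1 <= a)%N then (rho * N) *: exp_ann (a - p.+1) w else 0).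
Proof.
rewrite [X in _ = X - _](exp_coef_comm annA_comm
  (D := H (- p.+1%:Z)) (c := rho * N) (p := p.+1)) //.
  by rewrite addrK.
move=> i v i0; rewrite /annA /= !(linearZ_LR (H _)) /=.
have /eqP := H_comm (- p.+1%:Z) i v; rewrite subr_eq => /eqP ->.
rewrite !scalerDr addrC; congr (_ + _); rewrite !scalerA addrC subr_eq0 eqz_nat.
case: eqP => [->|_]; last by rewrite !mulr0.
have p0 : (p.+1%:R : K) != 0 by rewrite pnatr_eq0.
congr (_ *: _); rewrite mulrNz -pmulrn; field.
by rewrite nat1r.
Qed.

Lemma exp_ann_vac a v : hvac H v -> (0 < a)%N -> exp_ann a v = 0.
Proof.
move=> vv a0.
rewrite /exp_ann -(@exp_coef_uniq _ _ annA annA_comm (fun a => if a == 0%N then v else 0)) //.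
  by rewrite (gtn_eqF a0).
move=> b; rewrite big_nat big1 => [|j /andP[j1 jb]]; last first.
  case: ifP => _; last by rewrite raddf0 scaler0.
  by rewrite /annA /=; case: j j1 {jb} => // j _; rewrite vv !scaler0.
by case: b => [|b]; rewrite ?scale0r ?scaler0.
Qed.

(** The coefficient of z^(-n-1) in z^d exp_cre(z) exp_ann(z). The translation by e^b is left to the
    argument, and d stands for the value of the form that z^(b(0)) contributes. *)
Definition exp_vertex (d n : int) w : W :=
  \sum_(i \in [set i : nat | 0 <= i%:Z - n - 1 - d])
     exp_cre (absz (i%:Z - n - 1 - d)%R) (exp_ann i w).

Definition ann_bounded w := exists B : nat, forall i, (B <= i)%N -> exp_ann i w = 0.

Let exp_cre0 a : exp_cre a 0 = 0.
Proof. exact: (raddf0 (exp_cre_linear a)). Qed.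

Lemma exp_vertexE d n w B : (forall i, (B <= i)%N -> exp_ann i w = 0) ->
  exp_vertex d n w = \sum_(i < B)
    if 0 <= i%:Z - n - 1 - d then exp_cre (absz (i%:Z - n - 1 - d)%R) (exp_ann i w) else 0.
Proof.
move=> wB; rewrite /exp_vertex (@fsbig_nat_cond _ _ (fun i => 0 <= i%:Z - n - 1 - d) B).
  by rewrite big_mkcond.
by move=> i Bi _; rewrite wB.
Qed.

Lemma ann_bounded_cre p w : ann_bounded w -> ann_bounded (H (- p.+1%:Z) w).
Proof.
move=> [B wB]; exists (B + p.+1)%N => i Bi.
rewrite exp_ann_comm (wB i) ?(wB (i - p.+1)%N); [|lia..].
by rewrite linear0 scaler0 if_same subr0.
Qed.

(** Only the annihilation exponential fails to commute with the creation operator; the shift of its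
    index by p + 1 is absorbed into n. *)
Lemma exp_vertex_cre p d n w : ann_bounded w ->
  exp_vertex d n (H (- p.+1%:Z) w) =
  H (- p.+1%:Z) (exp_vertex d n w) - (rho * N) *: exp_vertex d (n - p.+1%:Z) w.
Proof.
move=> [B wB]; rewrite (@exp_vertexE _ _ w (p.+1 + B)); last by move=> i iB; apply: wB; lia.
rewrite (@exp_vertexE _ (n - p.+1%:Z) w B) // (@exp_vertexE _ _ (H _ w) (p.+1 + B)); last first.
  move=> i iB; rewrite exp_ann_comm (wB i) ?(wB (i - p.+1)%N); [|lia..].
  by rewrite linear0 scaler0 if_same subr0.
rewrite linear_sum scaler_sumr.
have -> : \sum_(i < B) (rho * N) *: (if 0 <= i%:Z - (n - p.+1%:Z) - 1 - d then
    exp_cre (absz (i%:Z - (n - p.+1%:Z) - 1 - d)%R) (exp_ann i w) else 0) =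
  \sum_(i < p.+1 + B) if 0 <= i%:Z - n - 1 - d then exp_cre (absz (i%:Z - n - 1 - d)%R)
    (if (p.+1 <= i)%N then (rho * N) *: exp_ann (i - p.+1) w else 0) else 0.
  rewrite [RHS]big_split_ord /= [X in _ = X + _]big1 ?add0r => [|i _]; last first.
    by rewrite leqNgt ltn_ord exp_cre0 if_same.
  apply: eq_bigr => i _; rewrite leq_addr addKn.
  rewrite (_ : (p.+1 + i)%N%:Z - n - 1 - d = i%:Z - (n - p.+1%:Z) - 1 - d); last lia.
  case: ifP => _; last exact: scaler0.
  exact/esym/(linearZ_LR (exp_cre_linear _)).
rewrite -sumrB; apply: eq_bigr => i _; case: ifP => _; last by rewrite raddf0 subrr.
rewrite exp_ann_comm -exp_cre_comm.
exact: (raddfB (exp_cre_linear _)).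
Qed.

Lemma exp_vertex_vac d n v : hvac H v ->
  exp_vertex d n v = if 0 <= - n - 1 - d then exp_cre (absz (- n - 1 - d)%R) v else 0.
Proof.
move=> vv; rewrite (@exp_vertexE _ _ _ 1) => [|i i1]; last exact: exp_ann_vac.
by rewrite big_ord_recl big_ord0 addr0 sub0r exp_ann_0.
Qed.

Lemma exp_cre_uniq (X : nat -> W) v : X 0%N = v ->
  (forall s : nat, s%:R *: X s = rho *: \sum_(j < s) H (- j.+1%:Z) (X (s - j.+1)%N)) ->
  forall s, X s = exp_cre s v.
Proof.
move=> X0 X_rec; apply: (exp_coef_uniq (A := creA) creA_comm X0) => s.
rewrite X_rec scaler_sumr big_add1 big_mkord; apply: eq_bigr => j _.
by rewrite /creA [RHS]scalerA mulfV ?scale1r ?pnatr_eq0.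
Qed.

End ExponentialOperators.

Section ExponentialMorphism.
Variables (K : numFieldType) (W V : lmodType K) (phi : {linear W -> V}).
Variables (HW : int -> {linear W -> W}) (HV : int -> {linear V -> V}).
Hypothesis phi_H : forall n w, phi (HW n w) = HV n (phi w).

Lemma exp_cre_morph rho a w : phi (exp_cre HW rho a w) = exp_cre HV rho a (phi w).
Proof.
have pow_morph r b : phi (mpow_coef (fun j v => j%:R^-1 *: (rho *: HW (- j%:Z) v)) r b w) =
    mpow_coef (fun j v => j%:R^-1 *: (rho *: HV (- j%:Z) v)) r b (phi w).
  elim: r b => [|r IH] b /=; first by case: eqP; rewrite ?raddf0.
  rewrite (linear_sum phi); apply: eq_bigr => j _.
  by rewrite (linearZ_LR phi) (linearZ_LR phi) phi_H IH.
rewrite /exp_cre /mexp_coef (linear_sum phi); apply: eq_bigr => r _.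
by rewrite (linearZ_LR phi) pow_morph.
Qed.

Lemma heis_comm_pullback N : injective phi ->
  (forall m n v, HV m (HV n v) - HV n (HV m v) = (if m + n == 0 then m%:~R * N else 0) *: v) ->
  forall m n w, HW m (HW n w) - HW n (HW m w) = (if m + n == 0 then m%:~R * N else 0) *: w.
Proof.
move=> phi_inj HV_comm m n w; apply: phi_inj.
by rewrite raddfB /= !phi_H HV_comm linearZ_LR.
Qed.

End ExponentialMorphism.

(** * The comparison map *)

Section VertexMorphism.
Variables (K : numFieldType) (V : voaData K) (V_voa : is_voa V).
Variables (L : zmodType) (form : L -> L -> int) (alpha : L).
Hypotheses (L_pos : pos_def_even_lattice form).
Variables (h : V) (eps : L -> V).
Local Notation H := (mode V_voa h).
Local Notation W := (lat_space K L).
Local Notation lv := (@lat_vec K L).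
Local Notation N := ((form alpha alpha)%:~R : K).
Hypothesis N_neq0 : N != 0.
Hypothesis H_comm : forall m n v,
  H m (H n v) - H n (H m v) = (if m + n == 0 then m%:~R * N else 0) *: v.
Hypothesis eps_vac : forall b, hvac H (eps b).
Hypothesis eps_H0 : forall b, H 0 (eps b) = (form alpha b)%:~R *: eps b.
Hypothesis eps_comm : forall b m n w, H m (vnth (eps b) n w) - vnth (eps b) n (H m w) =
  (form alpha b)%:~R *: vnth (eps b) (m + n) w.
Hypothesis eps_top : forall b c n, - form b c - 1 < n -> vnth (eps b) n (eps c) = 0.
Hypothesis eps_star : forall b c, vnth (eps b) (- form b c - 1) (eps c) = eps (b + c).
Hypothesis eps_rec : forall b c (s : nat),
  s%:R *: vnth (eps b) (- form b c - 1 - s%:Z) (eps c) = ((form b alpha)%:~R / N) *: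
  \sum_(j < s) H (- j.+1%:Z) (vnth (eps b) (- form b c - 1 - (s - j.+1)%N%:Z) (eps c)).
Hypothesis phi_inj : injective (fock_map H eps).

Definition lat_map : {linear W -> V} := fock_map H eps.
Local Notation phi := lat_map.
Local Notation HL := (@heis_lin L form alpha K).

Lemma lat_mapE (m : {mset nat}%mset) b : phi (lv m b) = creation H m (eps b).
Proof. exact: fock_mapU. Qed.

Lemma lat_map_heis n w : phi (HL n w) = H n (phi w).
Proof.
pose F : {linear W -> V} := phi \o HL n.
pose G : {linear W -> V} := H n \o phi.
suff FG (m : {mset nat}%mset) b : phi (HL n (lv m b)) = H n (phi (lv m b)).
  by apply: (malg_linearP (f := F) (g := G)) => -[m b]; exact: FG.
rewrite lat_mapE; case: n {F G} => [[|j]|j].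
- apply: etrans (congr1 phi (heis_zero form alpha K m b)) _; apply: etrans (linearZ_LR phi _ _) _.
  rewrite lat_mapE; apply/esym; exact: h0_creation.
- apply: etrans (congr1 phi (heis_pos form alpha K j m b)) _; apply: etrans (linearZ_LR phi _ _) _.
  rewrite lat_mapE (hpos_creation H_comm) // count_mem_mset.
  have [jm|/mset_eq0P ->] := boolP (j \in m); last by rewrite !mulr0 !scale0r.
  congr (_ *: _); apply: (perm_creation H_comm); rewrite -(perm_cons j).
  apply: perm_trans (perm_to_rem jm); rewrite perm_sym -{1}(msetB1K jm).
  exact: perm_msetD1.
apply: etrans (congr1 phi (heis_neg form alpha K j m b)) _; rewrite lat_mapE NegzE.
exact: (perm_creation H_comm _ (perm_msetD1 j m)).
Qed.

Lemma HL_comm m n w :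
  HL m (HL n w) - HL n (HL m w) = (if m + n == 0 then m%:~R * N else 0) *: w.
Proof. exact: (heis_comm_pullback lat_map_heis phi_inj H_comm). Qed.

Lemma exp_vopE b n m c : exp_vop form alpha b n (lv m c) =
  exp_vertex HL ((form b alpha)%:~R / N) (form b c) n (lv m (b + c)).
Proof. exact: lat_extE. Qed.

(** Induction on the monomial. On e^c, the recursion [eps_rec] and the leading term [eps_star]
    determine the expansion in V as the exponential of creation operators. Creation operators then
    have the same commutator with both sides. [ann_bounded] is carried along so that the sums stay
    finite. *)
Lemma lat_map_exp_vop b n w : phi (exp_vop form alpha b n w) = vnth (eps b) n (phi w).
Proof.
pose F : {linear W -> V} := phi \o exp_vop_lin form alpha K b n.
pose G : {linear W -> V} := mode V_voa (eps b) n \o phi.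
suff FG (m : {mset nat}%mset) c :
    phi (exp_vop form alpha b n (lv m c)) = vnth (eps b) n (phi (lv m c)).
  by apply: (malg_linearP (f := F) (g := G)) => -[m c]; exact: FG.
rewrite exp_vopE {F G w}.
set rho := (form b alpha)%:~R / N.
have rhoN : rho * N = (form alpha b)%:~R by rewrite divfK // (formC L_pos).
have vacL : hvac HL (lv mset0 (b + c)).
  move=> j; apply: phi_inj; rewrite lat_map_heis lat_mapE enum_mset0 raddf0.
  exact: eps_vac.
suff [_ S] : ann_bounded HL rho (lv m (b + c)) /\ forall n,
    phi (exp_vertex HL rho (form b c) n (lv m (b + c))) = vnth (eps b) n (phi (lv m c)).
  exact: S.
elim/mset_ind: m {n} => [|j m [bd IH]].
  split; first by exists 1%N => i i1; exact: (exp_ann_vac HL_comm).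
  move=> n; rewrite (exp_vertex_vac HL_comm) // lat_mapE enum_mset0 /=.
  case: ifP => n0; last first.
    by rewrite raddf0 eps_top //; lia.
  rewrite (exp_cre_morph lat_map_heis) lat_mapE enum_mset0 /=.
  rewrite -(@exp_cre_uniq _ _ _ _ H_comm rho
    (fun s => vnth (eps b) (- form b c - 1 - s%:Z) (eps c)) (eps (b + c))) //.
  - by congr (vnth _ _ _); lia.
  - by rewrite subr0 eps_star.
have lvS c' : lv (j +` m)%mset c' = HL (- j.+1%:Z) (lv m c') by exact/esym/heis_neg.
rewrite lvS; split; first exact: (ann_bounded_cre HL_comm).
move=> n; rewrite (exp_vertex_cre HL_comm) // (linearB phi) lat_map_heis.
rewrite (linearZ_LR phi) !IH lvS lat_map_heis.
rewrite rhoN; have := eps_comm b (- j.+1%:Z) n (phi (lv m c)).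
by rewrite [- _ + n]addrC => <-; rewrite opprB addrC subrK.
Qed.

(** Both sides obey the same normal-ordering recursion, in V by [vnth_normal_order]. *)
Lemma lat_map_vop s b n w :
  phi (lat_vop form alpha s b n w) = vnth (creation H s (eps b)) n (phi w).
Proof.
elim: s n w => [|j s IH] n w; first exact: lat_map_exp_vop.
rewrite lat_vop_cons (raddf_fsbig _ _ phi_inj) (vnth_normal_order V_voa).
apply: eq_fsbigr => i _; apply: etrans (linearZ_LR phi _ _) _; congr (_ *: _).
apply: etrans (linearD phi _ _) _; congr (_ + _).
  apply: etrans (lat_map_heis (- (j + i).+1%N%:Z) (lat_vop form alpha s b (n + i%:Z) w)) _.
  by rewrite IH.
apply: etrans (linearZ_LR phi _ _) _; congr (_ *: _); apply: etrans (IH _ _) _.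
exact: congr1 (lat_map_heis i%:Z w).
Qed.

Lemma lat_map_vnth u n w :
  phi (@vnth K (lattice_voa K form alpha) u n w) = vnth (phi u) n (phi w).
Proof.
pose F : {linear W -> V} := phi \o @lattice_lmode L form alpha K n w.
pose G : {linear W -> V} := lmode V_voa n (phi w) \o phi.
suff FG (m : {mset nat}%mset) b :
    phi (@vnth K (lattice_voa K form alpha) (lv m b) n w) = vnth (phi (lv m b)) n (phi w).
  by apply: (malg_linearP (f := F) (g := G)) => -[m b]; exact: FG.
by rewrite lattice_vnthU lat_map_vop lat_mapE.
Qed.

End VertexMorphism.

(** * The isomorphism *)

Lemma voa_isomorphic_inv (K : numFieldType) (V W : voaData K) (f : {linear W -> V}) :
  injective f -> (forall v, range f v) ->
  (forall u n w, f (vnth u n w) = vnth (f u) n (f w)) ->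
  f (vac W) = vac V -> f (conf W) = conf V -> voa_isomorphic V W.
Proof.
move=> f_inj f_surj fM f_vac f_conf.
have /choice[g gP] : forall v, exists w, f w = v by move=> v; have [w _ <-] := f_surj v; exists w.
have g_lin : linear g by move=> a u v; apply: f_inj; rewrite linearP !gP.
pose G : {linear V -> W} := HB.pack g (GRing.isLinear.Build K V W _ g g_lin).
exists G; split.
- by exists f => [v|w] /=; [exact: gP|apply: f_inj; exact: gP].
- by move=> u v n; apply: f_inj; rewrite fM /= !gP.
- by apply: f_inj; rewrite /= gP f_vac.
by apply: f_inj; rewrite /= gP f_conf.
Qed.

(** Polarisation: if v and its partner w are both isotropic, then v + w has norm 2. A square root of
    N / a, available in a closed field, adjusts the norm to N. *)
Lemma heisenberg_vector (K : numClosedFieldType) (V : voaData K) (N : K) :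
  is_voa V -> CFT_type V -> self_contragredient V -> N != 0 ->
  (exists2 v, @Vwt K V 1 v & v != 0) -> vac V != 0 /\
  exists h, [/\ @Vwt K V 1 h, vnth h 1 h = N *: vac V & Lvir 1 h = 0].
Proof.
move=> V_voa V_cft V_self N0 [v v1 v0].
have V1_sub := Vwt_subspace V_voa 1.
have Lv0 := L1_wt1 V_voa V_cft V_self v1.
have [vac0 [w w1 vw]] := quasi_primary_pairing V_voa V_cft V_self v1 Lv0 v0.
split=> //; have {}vw : vnth v 1 w = vac V by rewrite -vw.
have norm u : @Vwt K V 1 u -> exists a, vnth u 1 u = a *: vac V.
  by move=> u1; apply: (Vwt0_vac V_cft); have := Vwt_vnth V_voa 1 u1 u1.
have wv : vnth w 1 v = vac V.
  rewrite (vnth_skew V_voa v w 1) (@fsbig_nat_ord _ _ 1) => [|[|i] //= _]; last first.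
    have Vneg := Vwt_vnth V_voa (1 + i.+1%:Z) v1 w1.
    by rewrite (Vwt_neg V_cft _ Vneg) ?(vnth0l V_voa) ?scaler0 //; lia.
  rewrite big_ord_recl big_ord0 /= expr0 scale1r !addr0 vw (vnthN1_vac V_voa).
  by rewrite expr1z opprK scale1r.
have [u u1 [a a0 ua]] : exists2 u, @Vwt K V 1 u & exists2 a, a != 0 & vnth u 1 u = a *: vac V.
  have [a aE] := norm v v1; have [a0|a0] := eqVneq a 0; last by exists v => //; exists a.
  have [b bE] := norm w w1; have [b0|b0] := eqVneq b 0; last by exists w => //; exists b.
  exists (v + w); first exact: subspaceD.
  exists 2%:R; first by rewrite pnatr_eq0.
  rewrite (vnthDr V_voa) !(vnthDl V_voa) aE bE a0 b0 vw wv !scale0r add0r addr0.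
  by rewrite -mulr2n scaler_nat.
exists (sqrtC (N / a) *: u).
have h1 : @Vwt K V 1 (sqrtC (N / a) *: u) by exact: subspaceZ.
split=> //; last exact: L1_wt1.
by rewrite (vnthZr V_voa) (vnthZl V_voa) ua !scalerA -expr2 sqrtCK divfK.
Qed.

Section Main.
Variables (K : numClosedFieldType) (V : voaData K).
Hypotheses (V_voa : is_voa V) (V_self : self_contragredient V) (V_cft : CFT_type V).
Hypothesis V_c : ccharge V = 1.
Variables (L : zmodType) (form : L -> L -> int) (alpha : L).
Hypotheses (L_pos : pos_def_even_lattice form) (L_rank1 : rank_one_basis alpha).
Hypothesis V_ch : ch V = ch (lattice_voa K form alpha).

Local Notation k := (half_norm form alpha).
Local Notation N := ((form alpha alpha)%:~R : K).
Local Notation crd := (coord L_rank1).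
Let ell j := size (lat_shell form L_rank1 j).

Let k_gt0 : (0 < k)%N. Proof. exact: half_norm_gt0. Qed.

Let N_k : N = (2 * k)%N%:R. Proof. by rewrite (form_alpha L_pos L_rank1). Qed.

Let N_neq0 : N != 0. Proof. by rewrite N_k pnatr_eq0; lia. Qed.

Let V_dim (n : nat) : has_dim (@Vwt K V n) (\sum_(j < n.+1) size (parts (n - j)) * ell j)%N.
Proof.
(* Both central charges are 1, so the exponent n - 1/24 reads off weight n on both sides. *)
have := congr1 (fun f => f (n%:R - 1 / 24%:R)) V_ch; rewrite /ch V_c /= subrK.
rewrite (has_dim_dim (lattice_has_dim L_pos L_rank1 K n)) => <-.
exact: fin_dim_dim (Vwt_fin_dim V_voa n).
Qed.

Let mem_shell n b : (b \in lat_shell form L_rank1 n) = (k * `|crd b| ^ 2 == n)%N.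
Proof. exact: mem_lat_shell. Qed.

Let ell_gt0 n : (0 < ell n)%N -> exists m : nat, n = (k * m ^ 2)%N.
Proof.
rewrite /ell; case E: (lat_shell form L_rank1 n) => [//|b s] _; exists `|crd b|%N.
by apply/esym/eqP; rewrite -mem_shell E mem_head.
Qed.

Let ell_k : (0 < ell k)%N.
Proof.
have : alpha \in lat_shell form L_rank1 k.
  by rewrite mem_shell (coord_alpha L_pos) muln1.
by rewrite /ell; case: lat_shell.
Qed.

Let V1_neq0 : exists2 v, @Vwt K V 1 v & v != 0.
Proof.
(* The summand j = 0 already contributes: it counts alpha(-1) 1. *)
apply: has_dim_neq0 (V_dim 1) _; rewrite big_ord_recl ltn_addr // muln_gt0; apply/andP; split.
  have : ([mset 0%N] `+` mset0)%mset \in parts 1 by rewrite mem_parts mwtD1 mwt0.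
  by case: parts.
have : 0 \in lat_shell form L_rank1 0.
  by rewrite mem_shell -[0]/(0 : L) -(mulr0z alpha) (coordMz L_pos) muln0.
by rewrite /ell; case: lat_shell.
Qed.

Lemma voa_isomorphic_lattice : voa_isomorphic V (lattice_voa K form alpha).
Proof.
have [vac0 [h [h_wt h_norm h_prim]]] := heisenberg_vector V_voa V_cft V_self N_neq0 V1_neq0.
pose H := mode V_voa h.
have H_comm := heis_comm V_voa V_cft h_wt h_norm N_neq0.
have vac_dim := hvac_has_dim V_voa V_cft h_wt h_norm N_neq0 V_dim.
have vac_eq0 (n : nat) : ell n = 0%N -> forall v, @Vwt K V n v -> hvac H v -> v = 0.
  by move=> n0 v nv vv; have := vac_dim n; rewrite n0 => /has_dim0; apply.
have conf_sug : conf V = sugawara h N.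
  apply: (conf_sugawara (V_voa := V_voa)) => //.
  (* If 2 = k m2^2 and 3 = k m3^2, then m2 and m3 are both 1, as 2 and 3 are squarefree, and k would
     be both 2 and 3. *)
  have [e2|] := posnP (ell 2); first by left; exact: vac_eq0 e2.
  move=> /ell_gt0[m2 E2]; right; apply: (vac_eq0 3%N); apply/eqP; rewrite eqn0Ngt.
  apply/negP => /ell_gt0[m3]; move: E2; rewrite -!mulnn => E2 E3.
  have : (m2 < 2)%N by nia.
  have : (m3 < 2)%N by nia.
  by case: m2 m3 E2 E3 => [|[|//]] [|[|//]]; lia.
have hvac_level (n : nat) v : @Vwt K V n v -> hvac H v -> v != 0 ->
    exists m : nat, n = (k * m ^ 2)%N.
  move=> nv vv v0; apply: ell_gt0; rewrite lt0n; apply: contra v0 => /eqP n0.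
  by apply/eqP; exact: vac_eq0 n0 _ nv vv.
have hvac_k : exists v, [/\ @Vwt K V k v, hvac H v & v != 0].
  by have [v [kv vv] v0] := has_dim_neq0 (vac_dim k) ell_k; exists v.
have [E [E0 E_sec E_neq0 E_star E_span]] :=
  lattice_generators V_cft h_wt h_norm N_neq0 k_gt0 N_k conf_sug hvac_level hvac_k V_self.
pose eps b := E (crd b).
have eps_sec b : sector V_voa h k (crd b) (eps b) by exact: E_sec.
have form_crd b c : form b c = 2 * k%:Z * crd b * crd c by rewrite (formE L_pos L_rank1) PoszM.
have eps_vac b : hvac H (eps b) by case: (eps_sec b).
have eps_H0 b : H 0 (eps b) = (form alpha b)%:~R *: eps b.
  by case: (eps_sec b) => _ ->; rewrite form_crd (coord_alpha L_pos) mulr1.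
have eps_comm b m n w : H m (vnth (eps b) n w) - vnth (eps b) n (H m w) =
    (form alpha b)%:~R *: vnth (eps b) (m + n) w by exact: heis_primary_comm.
have eps_top b c n : - form b c - 1 < n -> vnth (eps b) n (eps c) = 0.
  rewrite form_crd; exact: (sector_top k_gt0 N_k conf_sug (eps_sec b) (eps_sec c)).
have eps_star b c : vnth (eps b) (- form b c - 1) (eps c) = eps (b + c).
  by rewrite form_crd [LHS]E_star /eps (coordD L_pos).
have eps_rec b c (s : nat) :
    s%:R *: vnth (eps b) (- form b c - 1 - s%:Z) (eps c) = ((form b alpha)%:~R / N) *:
    \sum_(j < s) H (- j.+1%:Z) (vnth (eps b) (- form b c - 1 - (s - j.+1)%N%:Z) (eps c)).
  rewrite form_crd.
  rewrite [LHS](star_rec N_neq0 k_gt0 N_k conf_sug s (eps_sec b) (eps_sec c)).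
  (* The factor rho = (b, alpha) / (alpha, alpha) of the exponentials is the coordinate of b, that
     is, the charge in [star_rec]. *)
  congr (_ *: _); rewrite (_ : form b alpha = crd b * form alpha alpha).
    by rewrite intrM mulfK.
  by rewrite !form_crd !(coord_alpha L_pos); ring.
have mu_inj : injective (fun b => (form alpha b)%:~R : K).
  move=> b c /eqP; rewrite eqr_int !form_crd (coord_alpha L_pos) => /eqP bc.
  apply: (coord_inj (L_rank1 := L_rank1)); nia.
have eps_free : free_family eps.
  by apply: (eigen_free mu_inj _ eps_H0) => b; exact: E_neq0.
have phi_inj : injective (fock_map H eps) by exact: (fock_map_inj N_neq0 H_comm eps_vac eps_free).
pose phi := lat_map V_voa h eps.
have rphi := range_subspace H eps.
have eps_range a u : sector V_voa h k a u -> range (fock_map H eps) u.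
  move=> /E_span[c ->]; apply: subspaceZ => //.
  exists (mkmalgU (mset0, alpha *~ a) 1) => //.
  by rewrite fock_mapU enum_mset0 /= /eps (coordMz L_pos).
have vac_range n v : @Vwt K V n v -> hvac H v -> range (fock_map H eps) v.
  move=> nv vv; have [->|v0] := eqVneq v 0; first by exists 0; rewrite ?raddf0.
  case: n nv => n nv; last by case/eqP: v0; exact: Vwt_neg nv.
  have [[|m] nE] := hvac_level n v nv vv v0.
    move: nv; rewrite nE muln0 => /(Vwt0_vac V_cft)[c ->].
    by apply: subspaceZ => //; apply: (eps_range 0); exact: sector_vac.
  rewrite nE in nv.
  have [vp [vn [-> vp_sec vn_sec]]] :=
    sector_split V_cft h_wt h_norm N_neq0 k_gt0 N_k conf_sug (ltn0Sn m) nv vv.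
  by apply: subspaceD => //; [exact: eps_range vp_sec|exact: eps_range vn_sec].
have phi_surj v : range phi v.
  move: v; apply: (Vwt_ind V_voa) => // n v nv.
  exact: (fock_map_onto N_neq0 H_comm (Vwt_subspace V_voa) (heis_wt V_voa h_wt N_neq0)
    (Vwt_neg V_cft) vac_range nv).
apply: (@voa_isomorphic_inv K V (lattice_voa K form alpha) phi) => //.
- exact: lat_map_vnth.
- by rewrite [LHS]lat_mapE enum_mset0 /= /eps -(mulr0z alpha) (coordMz L_pos).
rewrite conf_sug /sugawara /=; apply: etrans (linearZ_LR phi _ _) _; congr (_ *: _).
rewrite [LHS]lat_mapE enum_msetn /= /eps -(mulr0z alpha) (coordMz L_pos) E0.
by rewrite (vnthN1_vac V_voa).
Qed.

End Main.

Local Open Scope complex_scope.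

Theorem theorem8p2 (R : realType) (V : voaData R[i])
    (L : zmodType) (form : L -> L -> int) (alpha : L)
    (hV : is_voa V) (hsimple : voa_simple V) (hrational : voa_rational V)
    (hC2 : C2_cofinite V) (hself : self_contragredient V) (hCFT : CFT_type V)
    (hc : ccharge V = 1) (hct : effective_central_charge V 1)
    (hL : pos_def_even_lattice form) (hrank : rank_one_basis alpha)
    (hch : ch V = ch (lattice_voa R[i] form alpha)) :
  voa_isomorphic V (lattice_voa R[i] form alpha).
Proof. exact: (voa_isomorphic_lattice hV hself hCFT hc hL hrank hch). Qed.
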